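(* With the problem (LDR), the feasible set $\mathcal F_M$, the matrix $\mathcal Q$ and the cone $\hat\Xi$ defined in the context, the following 0-1 copositive program is an exact reformulation of (LDR): $$\min\ w^\top x+r+t$$ over $(Q,q,r,t,Y,y_0,p_0,\lambda,T,\Lambda,(\theta_i,\Gamma_i,\omega_i,\rho_i)_{i=1}^d,x)\in\mathcal F_M$, subject to $$r\,e_{k+1}e_{k+1}^\top-\mathcal Q\in\mathcal{COP}(\hat\Xi).$$
   Context: Data. $\mathcal X\subseteq\{0,1\}^d$, $w\in\mathbb R^d$, $A\in\mathbb R^{m\times n}$; $c(\xi)=C\xi+c_0$, $v(\xi)=V\xi+v_0$ with $C,V\in\mathbb R^{n\times k}$, $c_0,v_0\in\mathbb R^n$; $b_x(\xi)=B_x\xi+b_{x0}$ with $B_x=\sum_{i=1}^dB_ix_i+B_0$, $b_{x0}=\sum_{i=1}^db_ix_i+b_0$, $B_i\in\mathbb R^{m\times k}$, $b_i\in\mathbb R^m$. The support set is $\mathcal S=\{\xi\in\mathbb R^k: W\xi\ge h\}$, $W\in\mathbb R^{l\times k}$, $h\in\mathbb R^l$, assumed compact. $\mu_0\in\mathbb R^k$, $\Sigma_0\in\mathbb R^{k\times k}$ symmetric positive definite (empirical mean and covariance), $\gamma_1\ge0$, $\gamma_2\ge1$. The ambiguity set $\mathcal D_M$ is the set of all probability measures $F$ with $\mathbb P_F(\xi\in\mathcal S)=1$, $(\mathbb E_F[\xi]-\mu_0)^\top\Sigma_0^{-1}(\mathbb E_F[\xi]-\mu_0)\le\gamma_1$,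 $\mathbb E_F[(\xi-\mu_0)(\xi-\mu_0)^\top]\preceq\gamma_2\Sigma_0$. Standing assumptions. $c(\xi),v(\xi),b_x(\xi)$ are square-integrable under every $F\in\mathcal D_M$, and for every $x\in\mathcal X$ and $F\in\mathcal D_M$ the set $\{y\in\mathbb R^n:Ay\le b_x(\xi)\}$ is almost surely nonempty and bounded. The polyhedral cone $\hat\Xi=\{z\in\mathbb R^{k+1}:\mathcal Hz\ge0\}$, with $\mathcal H=[W\,|\,-h]\in\mathbb R^{l\times(k+1)}$, is full dimensional (no implicit equalities). Problem (LDR) (linear decision rules $y(\xi)=Y\xi+y_0$, $p(\xi)=P\xi+p_0$): $$\min_{x\in\mathcal X,\ \lambda\ge0,\ P\in\mathbb R^{m\times k},\ p_0\in\mathbb R^m,\ Y\in\mathbb R^{n\times k},\ y_0\in\mathbb R^n}\ w^\top x+\sup_{F\in\mathcal D_M}\mathbb E_F[b_x(\xi)^\top p(\xi)+c(\xi)^\top y(\xi)]$$ subject to $A^\top p(\xi)+\lambda c(\xi)=v(\xi)$, $p(\xi)\ge0$, $Ay(\xi)\le\lambda b_x(\xi)$ for all $\xi\in\mathcal S$. The set $\mathcal F_M$. Let $M>0$ be a sufficiently large (big-M) constant; $\mathbf 1_r$ is the all-ones vector in $\mathbb R^r$, $\mathbf 1_{k\times k}$ the all-ones matrix; vector/matrix inequalities $\le,\ge$ are entrywise; $X\cdot Y=\mathrm{Tr}(X^\top Y)$; $\|\cdot\|$ is the Euclidean norm. $\mathcal F_M$ is the set of tuples with $Q\in\mathbb R^{k\times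 k}$ symmetric, $q\in\mathbb R^k$, $r,t,\lambda\in\mathbb R$, $Y\in\mathbb R^{n\times k}$, $y_0\in\mathbb R^n$, $p_0\in\mathbb R^m$, $T,\Lambda\in\mathbb R^{m\times l}$, $\theta_i\in\mathbb R$, $\Gamma_i\in\mathbb R^{k\times k}$, $\omega_i\in\mathbb R^m$, $\rho_i\in\mathbb R^k$, $x\in\mathcal X$ satisfying: - $t\ge(\gamma_2\Sigma_0+\mu_0\mu_0^\top)\cdot Q+\mu_0^\top q+\sqrt{\gamma_1}\,\|\Sigma_0^{1/2}(q+2Q\mu_0)\|$, $Q\succeq0$, $\lambda\ge0$; - for $i=1,\dots,d$: $B_i^\top TW-(1-x_i)M\mathbf 1_{k\times k}\le\Gamma_i\le B_i^\top TW+(1-x_i)M\mathbf 1_{k\times k}$, $-x_iM\mathbf 1_{k\times k}\le\Gamma_i\le x_iM\mathbf 1_{k\times k}$; - for $i=1,\dots,d$: $\lambda-M(1-x_i)\le\theta_i\le Mx_i$, $0\le\theta_i\le\lambda$; - for $i=1,\dots,d$: $p_0-(1-x_i)M\mathbf 1_m\le\omega_i\le p_0+(1-x_i)M\mathbf 1_m$, $-x_iM\mathbf 1_m\le\omega_i\le x_iM\mathbf 1_m$; - for $i=1,\dots,d$: $(TW)^\top b_i-(1-x_i)M\mathbf 1_k\le\rho_i\le(TW)^\top b_i+(1-x_i)M\mathbf 1_k$, $-x_iM\mathbf 1_k\le\rho_i\le x_iM\mathbf 1_k$; - $AY+\Lambda W=\sum_{i=1}^d\theta_iB_i+\lambda B_0$,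 $\Lambda h-Ay_0+\sum_{i=1}^d\theta_ib_i+\lambda b_0\ge0$, $\Lambda\ge0$; - $A^\top TW+\lambda C=V$, $A^\top p_0+\lambda c_0=v_0$, $Th+p_0\ge0$, $T\ge0$. The matrix $\mathcal Q$ (symmetric, of order $k+1$) is $$\mathcal Q=\begin{bmatrix}\tfrac12(N+N^\top)-Q & g\\ g^\top & b_{x0}^\top p_0+c_0^\top y_0\end{bmatrix},\quad N=\sum_{i=1}^d\Gamma_i+B_0^\top TW+C^\top Y,$$ $$g=\tfrac12\Big(\sum_{i=1}^dB_i^\top\omega_i+B_0^\top p_0+\sum_{i=1}^d\rho_i+(TW)^\top b_0+C^\top y_0+Y^\top c_0-q\Big).$$ $e_{k+1}\in\mathbb R^{k+1}$ is the last standard basis vector. For a closed convex cone $\mathcal K\subseteq\mathbb R^N$, $\mathcal{COP}(\mathcal K)$ is the set of symmetric $N\times N$ matrices $X$ with $z^\top Xz\ge0$ for all $z\in\mathcal K$. Exact reformulation means the two problems have the same optimal value and the same optimal decisions $x$. *)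

(* Defs.v *)
From HB Require Import structures.
From mathcomp Require Import all_boot all_order all_algebra.
From mathcomp Require Import all_classical all_reals all_analysis.

Set Implicit Arguments.
Unset Strict Implicit.
Unset Printing Implicit Defensive.

Import Order.TTheory GRing.Theory Num.Theory.
Import numFieldNormedType.Exports.

Local Open Scope classical_set_scope.
Local Open Scope ring_scope.

(** * Matrices *)

Definition dotv (R : realType) (p : nat) (u v : 'cV[R]_p) : R :=
  (u^T *m v) ord0 ord0.

(* The library norm on 'cV_p is the sup norm, hence this definition. *)
Definition enorm (R : realType) (p : nat) (u : 'cV[R]_p) : R :=
  Num.sqrt (dotv u u).

Definition frob (R : realType) (p q : nat) (X Y : 'M[R]_(p, q)) : R :=
  \tr (X^T *m Y).

Definition mxle (R : realType) (p q : nat) (X Y : 'M[R]_(p, q)) : Prop :=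
  forall i j, X i j <= Y i j.

Definition symmx (R : realType) (p : nat) (X : 'M[R]_p) : Prop := X^T = X.

Definition psdmx (R : realType) (p : nat) (X : 'M[R]_p) : Prop :=
  symmx X /\ forall u : 'cV[R]_p, 0 <= dotv u (X *m u).

Definition pdmx (R : realType) (p : nat) (X : 'M[R]_p) : Prop :=
  symmx X /\ forall u : 'cV[R]_p, u != 0 -> 0 < dotv u (X *m u).

Definition loewner_le (R : realType) (p : nat) (X Y : 'M[R]_p) : Prop :=
  psdmx (Y - X).

(* S is the principal square root of X (unique when it exists; it exists for
   every positive semidefinite X). *)
Definition is_sqrtmx (R : realType) (p : nat) (X S : 'M[R]_p) : Prop :=
  psdmx S /\ S *m S = X.

Definition COP (R : realType) (p : nat) (K : set 'cV[R]_p) : set 'M[R]_p :=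
  [set X | symmx X /\ forall z, K z -> 0 <= dotv z (X *m z)].

(** * Problem data *)

(* [cC], [vV], [cc0], [vv0] are the coefficients C, V, c_0, v_0. *)
Record data (R : realType) (d m n k l : nat) : Type := Data {
  X : {set {ffun 'I_d -> bool}};
  w : 'cV[R]_d;
  A : 'M[R]_(m, n);
  cC : 'M[R]_(n, k);
  cc0 : 'cV[R]_n;
  vV : 'M[R]_(n, k);
  vv0 : 'cV[R]_n;
  B : 'I_d -> 'M[R]_(m, k);
  B0 : 'M[R]_(m, k);
  b : 'I_d -> 'cV[R]_m;
  b0 : 'cV[R]_m;
  W : 'M[R]_(l, k);
  h : 'cV[R]_l;
  mu0 : 'cV[R]_k;
  Sigma0 : 'M[R]_k;
  gamma1 : R;
  gamma2 : R }.

Definition bit (R : realType) (d : nat) (x : {ffun 'I_d -> bool}) (i : 'I_d) : R :=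
  (x i)%:R.

Definition wx (R : realType) (d m n k l : nat) (D : data R d m n k l)
    (x : {ffun 'I_d -> bool}) : R :=
  \sum_(i < d) w D i ord0 * bit R x i.

Definition c_of (R : realType) (d m n k l : nat) (D : data R d m n k l)
    (xi : 'cV[R]_k) : 'cV[R]_n := cC D *m xi + cc0 D.

Definition v_of (R : realType) (d m n k l : nat) (D : data R d m n k l)
    (xi : 'cV[R]_k) : 'cV[R]_n := vV D *m xi + vv0 D.

Definition Bx (R : realType) (d m n k l : nat) (D : data R d m n k l)
    (x : {ffun 'I_d -> bool}) : 'M[R]_(m, k) :=
  \sum_(i < d) bit R x i *: B D i + B0 D.

Definition bx0 (R : realType) (d m n k l : nat) (D : data R d m n k l)
    (x : {ffun 'I_d -> bool}) : 'cV[R]_m :=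
  \sum_(i < d) bit R x i *: b D i + b0 D.

Definition bx_of (R : realType) (d m n k l : nat) (D : data R d m n k l)
    (x : {ffun 'I_d -> bool}) (xi : 'cV[R]_k) : 'cV[R]_m :=
  Bx D x *m xi + bx0 D x.

Definition supp (R : realType) (d m n k l : nat) (D : data R d m n k l) :
    set 'cV[R]_k :=
  [set xi | mxle (h D) (W D *m xi)].

Definition calH (R : realType) (d m n k l : nat) (D : data R d m n k l) :
    'M[R]_(l, k + 1) := row_mx (W D) (- h D).

Definition Xihat (R : realType) (d m n k l : nat) (D : data R d m n k l) :
    set 'cV[R]_(k + 1) :=
  [set z | mxle 0 (calH D *m z)].

(** * Ambiguity set *)

(* R^k with its Borel sigma-algebra. *)
Definition borelV (R : realType) (k : nat) :=
  g_sigma_algebraType (@open 'cV[R]_k).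

(* [fine] is harmless for the probabilities of [DM] below: they are carried by
   [supp D], so that all moments are finite as soon as [supp D] is bounded. *)
Definition meanV (R : realType) (k : nat) (F : probability (borelV R k) R) :
    'cV[R]_k :=
  \col_i fine ('E_F[fun xi : 'cV[R]_k => xi i ord0])%E.

Definition centered_second_moment (R : realType) (k : nat)
    (F : probability (borelV R k) R) (mu : 'cV[R]_k) : 'M[R]_k :=
  \matrix_(i, j)
    fine ('E_F[fun xi : 'cV[R]_k => ((xi - mu) *m (xi - mu)^T) i j])%E.

Definition DM (R : realType) (d m n k l : nat) (D : data R d m n k l) :
    set (probability (borelV R k) R) :=
  [set F : probability (borelV R k) R |
    [/\ F (supp D) = 1%E,
        dotv (meanV F - mu0 D) (invmx (Sigma0 D) *m (meanV F - mu0 D))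
          <= gamma1 D
      & loewner_le (centered_second_moment F (mu0 D)) (gamma2 D *: Sigma0 D)]].

(* mu and Sigma are the empirical mean and covariance of a finite sample drawn
   from S; both usual normalizations 1/N and 1/(N-1) of the empirical
   covariance are allowed. *)
Definition empirical_moments (R : realType) (k : nat) (S : set 'cV[R]_k)
    (mu : 'cV[R]_k) (Sigma : 'M[R]_k) : Prop :=
  exists (N : nat) (s : 'I_N -> 'cV[R]_k),
    let scatter := \sum_(j < N) (s j - mu) *m (s j - mu)^T in
    [/\ (0 < N)%N,
        forall j, S (s j),
        mu = N%:R^-1 *: \sum_(j < N) s j
      & Sigma = N%:R^-1 *: scatter \/ Sigma = (N.-1)%:R^-1 *: scatter].

Definition square_integrable (R : realType) (k p : nat)
    (F : probability (borelV R k) R) (f : 'cV[R]_k -> 'cV[R]_p) : Prop :=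
  forall i, (fun xi : borelV R k => f xi i ord0) \in Lfun F 2%:E.

Definition standing_integrability (R : realType) (d m n k l : nat)
    (D : data R d m n k l) : Prop :=
  forall F : probability (borelV R k) R, DM D F ->
    [/\ square_integrable F (c_of D), square_integrable F (v_of D)
      & forall x, x \in X D -> square_integrable F (bx_of D x)].

Definition standing_bounded (R : realType) (d m n k l : nat)
    (D : data R d m n k l) : Prop :=
  forall (x : {ffun 'I_d -> bool}) (F : probability (borelV R k) R),
    x \in X D -> DM D F ->
    {ae F, forall xi,
      let Yset := [set y : 'cV[R]_n | mxle (A D *m y) (bx_of D x xi)] in
      Yset !=set0 /\ bounded_set Yset}.

(** * Linear decision rule problem *)

Record ldr_var (R : realType) (d m n k : nat) : Type := LdrVar {
  ldr_x : {ffun 'I_d -> bool};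
  ldr_lambda : R;
  ldr_P : 'M[R]_(m, k);
  ldr_p0 : 'cV[R]_m;
  ldr_Y : 'M[R]_(n, k);
  ldr_y0 : 'cV[R]_n }.

Definition ldr_p (R : realType) (d m n k : nat) (u : ldr_var R d m n k)
    (xi : 'cV[R]_k) : 'cV[R]_m := ldr_P u *m xi + ldr_p0 u.

Definition ldr_y (R : realType) (d m n k : nat) (u : ldr_var R d m n k)
    (xi : 'cV[R]_k) : 'cV[R]_n := ldr_Y u *m xi + ldr_y0 u.

Definition ldr_feasible (R : realType) (d m n k l : nat)
    (D : data R d m n k l) : set (ldr_var R d m n k) :=
  [set u |
    [/\ ldr_x u \in X D, 0 <= ldr_lambda u &
      forall xi, supp D xi ->
        [/\ (A D)^T *m ldr_p u xi + ldr_lambda u *: c_of D xi = v_of D xi,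
            mxle 0 (ldr_p u xi)
          & mxle (A D *m ldr_y u xi) (ldr_lambda u *: bx_of D (ldr_x u) xi)]]].

Definition ldr_objective (R : realType) (d m n k l : nat)
    (D : data R d m n k l) (u : ldr_var R d m n k) : \bar R :=
  ((wx D (ldr_x u))%:E +
   ereal_sup [set 'E_F[fun xi : 'cV[R]_k =>
                   (dotv (bx_of D (ldr_x u) xi) (ldr_p u xi)
                    + dotv (c_of D xi) (ldr_y u xi))%R] | F in DM D])%E.

(** * Copositive program *)

Record cop_var (R : realType) (d m n k l : nat) : Type := CopVar {
  cop_Q : 'M[R]_k;
  cop_q : 'cV[R]_k;
  cop_r : R;
  cop_t : R;
  cop_Y : 'M[R]_(n, k);
  cop_y0 : 'cV[R]_n;
  cop_p0 : 'cV[R]_m;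
  cop_lambda : R;
  cop_T : 'M[R]_(m, l);
  cop_Lambda : 'M[R]_(m, l);
  cop_theta : 'I_d -> R;
  cop_Gamma : 'I_d -> 'M[R]_k;
  cop_omega : 'I_d -> 'cV[R]_m;
  cop_rho : 'I_d -> 'cV[R]_k;
  cop_x : {ffun 'I_d -> bool} }.

(* The big-M linearization "Z = x_i U" of a product with a binary variable. *)
Definition bigM (R : realType) (p q : nat) (M xi : R) (U Z : 'M[R]_(p, q)) :
    Prop :=
  [/\ mxle (U - ((1 - xi) * M) *: const_mx 1) Z,
      mxle Z (U + ((1 - xi) * M) *: const_mx 1),
      mxle (- ((xi * M) *: const_mx 1)) Z
    & mxle Z ((xi * M) *: const_mx 1)].

(* [Sh] stands for the square root of [Sigma0 D]. *)
Definition FM (R : realType) (d m n k l : nat) (D : data R d m n k l)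
    (Sh : 'M[R]_k) (M : R) : set (cop_var R d m n k l) :=
  [set u |
    let Q := cop_Q u in let q := cop_q u in
    let lambda := cop_lambda u in
    let p0 := cop_p0 u in
    let Lambda := cop_Lambda u in
    let T := cop_T u in let TW := cop_T u *m W D in
    let x := bit R (cop_x u) in
    [/\ cop_x u \in X D,
        [/\ frob (gamma2 D *: Sigma0 D + mu0 D *m (mu0 D)^T) Q
              + dotv (mu0 D) q
              + Num.sqrt (gamma1 D)
                * enorm (Sh *m (q + 2 *: (Q *m mu0 D))) <= cop_t u,
            psdmx Q & 0 <= lambda],
        forall i : 'I_d,
          [/\ bigM M (x i) ((B D i)^T *m TW) (cop_Gamma u i),
              (lambda - M * (1 - x i) <= cop_theta u i <= M * x i)
                /\ (0 <= cop_theta u i <= lambda),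
              bigM M (x i) p0 (cop_omega u i)
            & bigM M (x i) (TW^T *m b D i) (cop_rho u i)],
        [/\ A D *m cop_Y u + Lambda *m W D
              = \sum_(i < d) cop_theta u i *: B D i + lambda *: B0 D,
            mxle 0 (Lambda *m h D - A D *m cop_y0 u
                    + \sum_(i < d) cop_theta u i *: b D i + lambda *: b0 D)
          & mxle 0 Lambda]
      & [/\ (A D)^T *m TW + lambda *: cC D = vV D,
            (A D)^T *m p0 + lambda *: cc0 D = vv0 D,
            mxle 0 (T *m h D + p0)
          & mxle 0 T]]].

Definition calQ (R : realType) (d m n k l : nat) (D : data R d m n k l)
    (u : cop_var R d m n k l) : 'M[R]_(k + 1) :=
  let TW := cop_T u *m W D in
  let N := \sum_(i < d) cop_Gamma u i + (B0 D)^T *m TW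
           + (cC D)^T *m cop_Y u in
  let g := 2^-1 *: (\sum_(i < d) (B D i)^T *m cop_omega u i
                    + (B0 D)^T *m cop_p0 u
                    + \sum_(i < d) cop_rho u i
                    + TW^T *m b0 D
                    + (cC D)^T *m cop_y0 u
                    + (cop_Y u)^T *m cc0 D
                    - cop_q u) in
  block_mx (2^-1 *: (N + N^T) - cop_Q u) g
           g^T ((bx0 D (cop_x u))^T *m cop_p0 u + (cc0 D)^T *m cop_y0 u).

Definition elast (R : realType) (k : nat) : 'cV[R]_(k + 1) :=
  delta_mx (rshift k ord0) ord0.

Definition cop_feasible (R : realType) (d m n k l : nat)
    (D : data R d m n k l) (Sh : 'M[R]_k) (M : R) :
    set (cop_var R d m n k l) :=
  [set u | FM D Sh M u /\
    COP (Xihat D) (cop_r u *: (elast R k *m (elast R k)^T) - calQ D u)].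

Definition cop_objective (R : realType) (d m n k l : nat)
    (D : data R d m n k l) (u : cop_var R d m n k l) : \bar R :=
  (wx D (cop_x u) + cop_r u + cop_t u)%:E.

(** * Exact reformulation of minimization problems *)

Definition opt_value (R : realType) (U : Type) (E : set U) (f : U -> \bar R) :
    \bar R := ereal_inf [set f u | u in E].

Definition opt_solutions (R : realType) (U : Type) (E : set U)
    (f : U -> \bar R) : set U :=
  [set u | E u /\ forall u', E u' -> (f u <= f u')%E].

(* [x1] and [x2] extract the decision from a tuple of variables. *)
Definition exact_reformulation (R : realType) (Z U1 U2 : Type)
    (E1 : set U1) (f1 : U1 -> \bar R) (x1 : U1 -> Z)
    (E2 : set U2) (f2 : U2 -> \bar R) (x2 : U2 -> Z) : Prop :=
  opt_value E1 f1 = opt_value E2 f2 /\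
  x1 @` opt_solutions E1 f1 = x2 @` opt_solutions E2 f2.

(* Main.v *)
(* For a fixed x, a feasible linear decision rule is, by the affine Farkas lemma
   on the support S, a point with s = 1 of a polyhedral cone of tuples
   u = (T, Lambda, p0, Y, y0, lambda, s), hence a nonnegative combination of
   finitely many generators u_i.  Its cost obj_u(xi) is linear in u.  On generators
   with s_i = 0 the cost is nonnegative on S, because the recourse polytopes are
   nonempty and bounded; those on which it vanishes identically are dropped.

   Let alpha be the supremum of the levels v for which some F in the ambiguity set
   satisfies E_F[obj_{u_i}] >= v s_i for all i; then alpha is at most the worst-case
   cost of every feasible u.  With eta = xi - mu0, the moment curve
   xi |-> (obj_{u_i}(xi), eta, eta eta') can be separated from the convex set
   {(tau, e, Z) : tau >= v s for some v > alpha, e in the ellipsoid,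
   Z <= gamma2 Sigma0}, and the separating functional yields at once a feasible
   u* = sum_i a_i u_i and multipliers (Q, q, r, t) with r + t = alpha.  The
   functional cannot be degenerate (sum_i a_i s_i = 0): xi = mu0 forces Q = 0, then
   q = 0 because mu0 is interior to S, then a = 0 because the useless generators
   have been dropped.

   Thus for each x the copositive program without the big-M constraints attains the
   optimal value of the linear decision rule problem, and any M that dominates one
   optimal solution for each of the finitely many x is large enough. *)

Require Import Defs.
From HB Require Import structures.
From mathcomp Require Import all_boot all_order all_algebra finmap.
From mathcomp Require Import ring lra.
From mathcomp Require Import all_classical all_reals all_analysis measurable_realfun.

Set Implicit Arguments.
Unset Strict Implicit.
Unset Printing Implicit Defensive.

Import Order.TTheory GRing.Theory Num.Theory.
Import numFieldNormedType.Exports.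

Local Open Scope classical_set_scope.
Local Open Scope ring_scope.

(** * Polyhedral cones and Farkas' lemma *)

Section PolyhedralCones.
Variables (R : realFieldType) (E : vectType R).
Implicit Types (l : nat -> {scalar E}) (f : {scalar E}) (g : seq E).

(** Membership in the convex cone generated by [g]. Coefficients are indexed by [nat], so that their
    sign condition carries no bound; only the first [size g] matter. *)
Definition nonneg_comb g (x : E) : Prop :=
  exists2 a : nat -> R, (forall i, 0 <= a i)
    & x = \sum_(i < size g) a i *: g`_i.

Lemma nonneg_combD g x y :
  nonneg_comb g x -> nonneg_comb g y -> nonneg_comb g (x + y).
Proof.
move=> [a a0 ->] [b b0 ->]; exists (fun i => a i + b i).
  by move=> i; rewrite addr_ge0.
by rewrite -big_split; apply: eq_bigr => i _; rewrite scalerDl.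
Qed.

Lemma nonneg_combZ g c x : 0 <= c -> nonneg_comb g x -> nonneg_comb g (c *: x).
Proof.
move=> c0 [a a0 ->]; exists (fun i => c * a i).
  by move=> i; rewrite mulr_ge0.
by rewrite scaler_sumr; apply: eq_bigr => i _; rewrite scalerA.
Qed.

Lemma nonneg_comb0 g : nonneg_comb g 0.
Proof.
exists (fun=> 0) => //; rewrite big1 // => i _; exact: scale0r.
Qed.

Lemma nonneg_comb_mem g x : x \in g -> nonneg_comb g x.
Proof.
move=> xg; exists (fun i => (i == index x g)%:R) => [i|]; first exact: ler0n.
have ltx : (index x g < size g)%N by rewrite index_mem.
rewrite (bigD1 (Ordinal ltx)) //= eqxx scale1r nth_index // big1 ?addr0 //.
by move=> i; rewrite -val_eqE /= => /negPf ->; rewrite scale0r.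
Qed.

Lemma nonneg_comb_sum g (I : Type) (r : seq I) (P : pred I) (F : I -> E) :
  (forall i, P i -> nonneg_comb g (F i)) -> nonneg_comb g (\sum_(i <- r | P i) F i).
Proof.
move=> h; elim/big_ind: _ => //; first exact: nonneg_comb0.
exact: nonneg_combD.
Qed.

(* One step of the double description method: the cone generated by [g] is cut
   by the half-space [0 <= f]. *)
Definition cut_gens f g : seq E :=
  [seq u <- g | 0 <= f u] ++
  [seq f p.1 *: p.2 - f p.2 *: p.1 |
     p <- [seq (u, v) | u <- g, v <- g] & (0 < f p.1) && (f p.2 < 0)].

Lemma cut_gens_pos f g u : u \in g -> 0 <= f u -> u \in cut_gens f g.
Proof. by move=> ug fu; rewrite mem_cat mem_filter fu ug. Qed.

Lemma cut_gens_mix f g u v : u \in g -> v \in g -> 0 < f u -> f v < 0 ->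
  f u *: v - f v *: u \in cut_gens f g.
Proof.
move=> ug vg fu fv; rewrite mem_cat; apply/orP; right.
apply/mapP; exists (u, v) => //=; rewrite mem_filter /= fu fv /=.
by apply/allpairsP; exists (u, v).
Qed.

Lemma cut_gensP f g w : w \in cut_gens f g ->
  (w \in g /\ 0 <= f w) \/
  exists u v, [/\ u \in g, v \in g, 0 < f u, f v < 0 & w = f u *: v - f v *: u].
Proof.
rewrite mem_cat => /orP[|]; first by rewrite mem_filter => /andP[? ?]; left.
move=> /mapP[[u v]]; rewrite mem_filter => /andP[/= /andP[fu fv]].
move=> /allpairsP[[u' v'] /= [ug vg [eu ev]]] wE; right; exists u, v.
by rewrite eu ev in fu fv wE *; split.
Qed.

Lemma linear_comb f (I : Type) (r : seq I) (P : pred I) (a : I -> R) (v : I -> E) :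
  f (\sum_(i <- r | P i) a i *: v i) = \sum_(i <- r | P i) a i * f (v i).
Proof. by rewrite linear_sum; apply: eq_bigr => i _; rewrite linearZ. Qed.

Lemma scalarBZ f (a c : R) u v : f (a *: u - c *: v) = a * f u - c * f v.
Proof. by rewrite linearB !linearZ. Qed.

Lemma scalarDZ f (a : R) u v : f (a *: u + v) = a * f u + f v.
Proof. by rewrite linearD linearZ. Qed.

(** Split [x] into the parts [Z], [Pp], [Nn] coming from generators where [f] is zero, positive,
    negative. Since [f Pp + f Nn] is nonnegative, [Nn] is absorbed by a share of [Pp] through the
    mixed generators, and what remains of [Pp] has a nonnegative coefficient. *)
Lemma nonneg_comb_cut f g x :
  nonneg_comb g x -> 0 <= f x -> nonneg_comb (cut_gens f g) x.
Proof.
move=> [a a0 xE] fx.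
pose u (i : 'I_(size g)) := g`_i.
have ug i : u i \in g by apply: mem_nth.
pose Pp := \sum_(i < size g | 0 < f (u i)) a i *: u i.
pose Nn := \sum_(i < size g | f (u i) < 0) a i *: u i.
pose Z := \sum_(i < size g | f (u i) == 0) a i *: u i.
have xD : x = Z + Pp + Nn.
  rewrite xE /Z /Pp /Nn (bigID (fun i => f (u i) == 0)) /= -addrA; congr (_ + _).
  rewrite (bigID (fun i => 0 < f (u i))) /=; congr (_ + _); apply: eq_bigl => i.
    by case: ltgtP.
  by case: ltgtP.
have fZ : f Z = 0.
  by rewrite linear_comb big1 // => i /eqP ->; rewrite mulr0.
have hZ : nonneg_comb (cut_gens f g) Z.
  apply: nonneg_comb_sum => i /eqP fi; apply: nonneg_combZ => //.
  by apply: nonneg_comb_mem; apply: cut_gens_pos => //; rewrite fi.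
have hP : nonneg_comb (cut_gens f g) Pp.
  apply: nonneg_comb_sum => i fi; apply: nonneg_combZ => //.
  by apply: nonneg_comb_mem; apply: cut_gens_pos => //; apply: ltW.
have fP : f Pp = \sum_(i < size g | 0 < f (u i)) a i * f (u i).
  exact: linear_comb.
have fN : f Nn = \sum_(i < size g | f (u i) < 0) a i * f (u i).
  exact: linear_comb.
have fP0 : 0 <= f Pp by rewrite fP sumr_ge0 // => i fi; rewrite mulr_ge0 // ltW.
have mix : nonneg_comb (cut_gens f g) (f Pp *: Nn - f Nn *: Pp).
  have -> : f Pp *: Nn - f Nn *: Pp =
      \sum_(i < size g | 0 < f (u i)) \sum_(j < size g | f (u j) < 0)
        (a i * a j) *: (f (u i) *: u j - f (u j) *: u i).
    rewrite fP {1}/Pp scaler_suml scaler_sumr -sumrB; apply: eq_bigr => i _.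
    rewrite fN {1}/Nn scaler_suml scaler_sumr -sumrB; apply: eq_bigr => j _.
    rewrite scalerBr !scalerA; congr (_ *: _ - _ *: _); ring.
  apply: nonneg_comb_sum => i fi; apply: nonneg_comb_sum => j fj.
  apply: nonneg_combZ; first exact: mulr_ge0.
  by apply: nonneg_comb_mem; apply: cut_gens_mix.
have fPN : 0 <= f Pp + f Nn by move: fx; rewrite xD !linearD /= fZ add0r.
have [p0|p0] := eqVneq (f Pp) 0.
  (* With [f Pp = 0], the negative terms of [f Nn] must all vanish, hence so do their
     coefficients. *)
  have N0 : Nn = 0.
    have fNge : 0 <= f Nn by move: fPN; rewrite p0 add0r.
    have sum0 : \sum_(i < size g | f (u i) < 0) - (a i * f (u i)) = 0.
      apply/eqP; rewrite eq_le sumrN -fN oppr_le0 fNge /= fN -sumrN.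
      by apply: sumr_ge0 => i fi; rewrite -mulrN mulr_ge0 // oppr_ge0 ltW.
    rewrite /Nn big1 // => i fi.
    have h : \sum_(i < size g | f (u i) < 0) - (a i * f (u i)) == 0 by rewrite sum0.
    move: h; rewrite psumr_eq0; last first.
      by move=> j fj; rewrite -mulrN mulr_ge0 // oppr_ge0 ltW.
    move=> /allP /(_ i (mem_index_enum _)); rewrite fi /= oppr_eq0 mulf_eq0.
    by rewrite (lt_eqF fi) orbF => /eqP ->; rewrite scale0r.
  by rewrite xD N0 addr0; apply: nonneg_combD.
have p_gt0 : 0 < f Pp by rewrite lt_def p0.
have -> : x = Z + ((f Pp + f Nn) / f Pp) *: Pp + (f Pp)^-1 *: (f Pp *: Nn - f Nn *: Pp).
  rewrite xD -!addrA; congr (_ + _).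
  rewrite scalerBr !scalerA mulVf // scale1r addrCA addrC; congr (_ + _).
  rewrite -scalerBl -[LHS]scale1r; congr (_ *: _); field; exact: p0.
apply: nonneg_combD; last by apply: nonneg_combZ => //; rewrite invr_ge0.
by apply: nonneg_combD => //; apply: nonneg_combZ => //; rewrite divr_ge0.
Qed.

Lemma nonneg_comb_fullspace : exists g : seq E, forall x, nonneg_comb g x.
Proof.
pose e := vbasis (fullv : {vspace E}).
exists (e ++ [seq - u | u <- e]) => x.
rewrite (coord_vbasis (memvf x)); apply: nonneg_comb_sum => i _.
have ei : e`_i \in tval e by apply: mem_nth; rewrite size_tuple.
have [c0|c0] := leP 0 (coord (vbasis fullv) i x).
  by apply: nonneg_combZ => //; apply: nonneg_comb_mem; rewrite mem_cat ei.
rewrite -[_ *: _]opprK -scalerN -scaleNr; apply: nonneg_combZ.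
  by rewrite oppr_ge0 ltW.
apply: nonneg_comb_mem; rewrite mem_cat; apply/orP; right.
by apply/mapP; exists e`_i.
Qed.

(** Cutting the whole space by one half-space at a time keeps a finite list of generators: the
    Minkowski-Weyl theorem for cones. *)
Lemma polyhedral_cone_gens l s : exists2 g : seq E,
  (forall u, u \in g -> forall i, (i < s)%N -> 0 <= l i u) &
  (forall x, (forall i, (i < s)%N -> 0 <= l i x) -> nonneg_comb g x).
Proof.
elim: s => [|s [g g1 g2]].
  by have [g hg] := nonneg_comb_fullspace; exists g.
exists (cut_gens (l s) g).
  move=> w /cut_gensP[[wg fw] i|[u [v [ug vg fu fv ->]]] i]; rewrite ltnS leq_eqVlt.
    by move=> /predU1P[->//|]; apply: g1.
  rewrite scalarBZ => /predU1P[->|lti].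
    by rewrite subr_ge0 mulrC.
  rewrite -mulNr addr_ge0 // mulr_ge0 ?oppr_ge0 ?(ltW fu) ?(ltW fv) //; exact: g1.
move=> x hx; apply: nonneg_comb_cut; last exact: hx.
by apply: g2 => i lti; apply: hx; apply: ltnW.
Qed.

(** Induction on the number of forms. The multiplier [tau] of the last form is the largest of 0 and
    the ratios [f v / ls v] over the generators [v] of the previous cone with [ls v < 0]. Then
    [f - tau ls] is nonnegative on that cone, where the induction hypothesis applies. *)
Lemma farkas l s f :
  (forall x, (forall i, (i < s)%N -> 0 <= l i x) -> 0 <= f x) ->
  exists2 t : nat -> R, (forall i, 0 <= t i)
    & forall x, f x = \sum_(i < s) t i * l i x.
Proof.
elim: s f => [|s IH] f hf.
  exists (fun=> 0) => // x; rewrite big_ord0; apply/eqP; rewrite eq_le hf // andbT.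
  by rewrite -oppr_ge0 -linearN hf.
have [g g1 g2] := polyhedral_cone_gens l s.
pose ls := l s.
pose ratio v := if ls v < 0 then f v / ls v else 0.
pose tau := \big[Num.max/0]_(v <- g) ratio v.
have tau0 : 0 <= tau by apply: bigmax_ge_id.
have tau_ge v : v \in g -> ratio v <= tau.
  by move=> vg; apply: le_bigmax_seq.
have tauE : tau = 0 \/ exists2 v, v \in g & (ls v < 0) && (tau == f v / ls v).
  have : tau = 0 \/ exists2 v, v \in g & tau = ratio v.
    rewrite /tau; elim: g {g1 g2 tau tau0 tau_ge} => [|v g IHg]; first by rewrite big_nil; left.
    rewrite big_cons maxEle; case: ifP => _.
      by case: IHg => [->|[w wg ->]]; [left|right; exists w => //; rewrite inE wg orbT].
    by right; exists v => //; rewrite mem_head.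
  case=> [|[v vg E']]; first by left.
  move: E'; rewrite /ratio; case: ifP => lv E'; last by left.
  by right; exists v => //; rewrite lv E' eqxx.
have f'_lin : linear_for *%R (fun x => f x - tau * ls x).
  by move=> c x y /=; rewrite !scalarDZ; ring.
pose f'_mixin := GRing.isLinear.Build R E R *%R _ f'_lin.
pose f' : {scalar E} := HB.pack (fun x => f x - tau * ls x) f'_mixin.
have f'E x : f' x = f x - tau * ls x by [].
have f'ge0 v : v \in g -> 0 <= f' v.
  move=> vg; rewrite f'E; have [lv|lv|lv] := ltgtP (ls v) 0.
  - move: (tau_ge v vg); rewrite /ratio lv ler_ndivrMr // => h.
    by rewrite subr_ge0.
  - case: tauE => [->|[w wg /andP[lw /eqP ->]]].
      rewrite mul0r subr0; apply: hf => i; rewrite ltnS leq_eqVlt => /predU1P[->|]; first exact: ltW.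
      exact: g1.
    (* This combination stays in the cone and lies on the hyperplane [ls = 0]; nonnegativity of [f]
       there is the inequality wanted for [v]. *)
    have : 0 <= f (ls v *: w - ls w *: v).
      apply: hf => i; rewrite ltnS leq_eqVlt scalarBZ.
      move=> /predU1P[->|lti]; first by rewrite subr_ge0 mulrC.
      rewrite -mulNr addr_ge0 // mulr_ge0 ?oppr_ge0 ?(ltW lw) ?(ltW lv) //; exact: g1.
    rewrite scalarBZ => h.
    have -> : f v - f w / ls w * ls v = (ls v * f w - ls w * f v) / (- ls w).
      field; by rewrite lt_eqF.
    by rewrite divr_ge0 // oppr_ge0 ltW.
  - rewrite lv mulr0 subr0; apply: hf => i; rewrite ltnS leq_eqVlt => /predU1P[->|]; first by rewrite -/ls lv.
    exact: g1.
have [t t0 tE] : exists2 t : nat -> R, (forall i, 0 <= t i)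
    & forall x, f' x = \sum_(i < s) t i * l i x.
  apply: IH => x /g2[a a0 ->]; rewrite linear_comb sumr_ge0 // => i _.
  by rewrite mulr_ge0 // f'ge0 // mem_nth.
exists (fun i => if (i == s)%N then tau else t i) => [i|x]; first by case: ifP.
rewrite big_ord_recr /= eqxx; apply/eqP; rewrite -subr_eq -f'E tE; apply/eqP.
by apply: eq_bigr => i _; rewrite ltn_eqF.
Qed.

End PolyhedralCones.

(** * Separation of convex sets *)

Section Dot.
Variables (R : realType).
Implicit Types p : nat.

Lemma dotvE p (u v : 'cV[R]_p) : dotv u v = \sum_i u i ord0 * v i ord0.
Proof. by rewrite /dotv mxE; apply: eq_bigr => i _; rewrite mxE. Qed.

Lemma dotvC p (u v : 'cV[R]_p) : dotv u v = dotv v u.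
Proof. by rewrite !dotvE; apply: eq_bigr => i _; rewrite mulrC. Qed.

Lemma dotvDr p (u v w : 'cV[R]_p) : dotv u (v + w) = dotv u v + dotv u w.
Proof. by rewrite /dotv mulmxDr mxE. Qed.

Lemma dotvNr p (u v : 'cV[R]_p) : dotv u (- v) = - dotv u v.
Proof. by rewrite /dotv mulmxN mxE. Qed.

Lemma dotvBr p (u v w : 'cV[R]_p) : dotv u (v - w) = dotv u v - dotv u w.
Proof. by rewrite dotvDr dotvNr. Qed.

Lemma dotvZr p (u v : 'cV[R]_p) a : dotv u (a *: v) = a * dotv u v.
Proof. by rewrite /dotv -scalemxAr mxE. Qed.

Lemma dotv0r p (u : 'cV[R]_p) : dotv u 0 = 0.
Proof. by rewrite /dotv mulmx0 mxE. Qed.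

Lemma dotvDl p (u v w : 'cV[R]_p) : dotv (u + v) w = dotv u w + dotv v w.
Proof. by rewrite dotvC dotvDr !(dotvC w). Qed.

Lemma dotvNl p (u v : 'cV[R]_p) : dotv (- u) v = - dotv u v.
Proof. by rewrite dotvC dotvNr dotvC. Qed.

Lemma dotvBl p (u v w : 'cV[R]_p) : dotv (u - v) w = dotv u w - dotv v w.
Proof. by rewrite dotvDl dotvNl. Qed.

Lemma dotvZl p (u v : 'cV[R]_p) a : dotv (a *: u) v = a * dotv u v.
Proof. by rewrite dotvC dotvZr dotvC. Qed.

Lemma dotv0l p (u : 'cV[R]_p) : dotv 0 u = 0.
Proof. by rewrite dotvC dotv0r. Qed.

Lemma dotv_sumr p (I : Type) (r : seq I) (P : pred I) u (F : I -> 'cV[R]_p) :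
  dotv u (\sum_(i <- r | P i) F i) = \sum_(i <- r | P i) dotv u (F i).
Proof. by rewrite (big_morph _ (dotvDr u) (dotv0r u)). Qed.

Lemma dotv_suml p (I : Type) (r : seq I) (P : pred I) u (F : I -> 'cV[R]_p) :
  dotv (\sum_(i <- r | P i) F i) u = \sum_(i <- r | P i) dotv (F i) u.
Proof. by rewrite dotvC dotv_sumr; apply: eq_bigr => i _; rewrite dotvC. Qed.

Lemma dotv_mulmx p q (A : 'M[R]_(p, q)) u v :
  dotv u (A *m v) = dotv (A^T *m u) v.
Proof. by rewrite /dotv trmx_mul trmxK mulmxA. Qed.

Lemma dotv_ge0 p (u : 'cV[R]_p) : 0 <= dotv u u.
Proof. by rewrite dotvE sumr_ge0 // => i _; rewrite -expr2 sqr_ge0. Qed.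

Lemma dotv_eq0 p (u : 'cV[R]_p) : dotv u u = 0 -> u = 0.
Proof.
rewrite dotvE => /eqP; rewrite psumr_eq0 => [|i _]; last by rewrite -expr2 sqr_ge0.
move=> /allP h; apply/matrixP => i j; rewrite ord1 mxE.
by have := h i (mem_index_enum _); rewrite mulf_eq0 orbb => /eqP.
Qed.

Lemma dotv_delta p (u : 'cV[R]_p) i : dotv (delta_mx i ord0) u = u i ord0.
Proof.
rewrite dotvE (bigD1 i) //= mxE !eqxx mul1r big1 ?addr0 // => j ji.
by rewrite mxE (negPf ji) mul0r.
Qed.

Lemma dotv_nneg p (u v : 'cV[R]_p) : mxle 0 u -> mxle 0 v -> 0 <= dotv u v.
Proof.
move=> hu hv; rewrite dotvE sumr_ge0 // => i _.
by rewrite mulr_ge0 //; [move: (hu i ord0)|move: (hv i ord0)]; rewrite mxE.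
Qed.

Lemma dotv_col_mx p q (u1 v1 : 'cV[R]_p) (u2 v2 : 'cV[R]_q) :
  dotv (col_mx u1 u2) (col_mx v1 v2) = dotv u1 v1 + dotv u2 v2.
Proof. by rewrite /dotv tr_col_mx mul_row_col mxE. Qed.

(* Cauchy-Schwarz, from the nonnegativity of |(v.v) u - (u.v) v|^2. *)
Lemma dotv_sqr_le p (u v : 'cV[R]_p) : dotv u v ^+ 2 <= dotv u u * dotv v v.
Proof.
have [v0|v0] := eqVneq (dotv v v) 0.
  by rewrite (dotv_eq0 v0) !dotv0r mulr0 expr0n.
have vgt0 : 0 < dotv v v by rewrite lt_def v0 dotv_ge0.
have := dotv_ge0 (dotv v v *: u - dotv u v *: v).
rewrite dotvBr !dotvBl !dotvZr !dotvZl (dotvC v u) => h.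
have {}h : 0 <= dotv v v * (dotv u u * dotv v v - dotv u v ^+ 2).
  by apply: le_trans h _; rewrite le_eqVlt; apply/orP; left; apply/eqP; ring.
by rewrite -subr_ge0 -(pmulr_rge0 _ vgt0).
Qed.

Lemma enorm_ge0 p (u : 'cV[R]_p) : 0 <= enorm u.
Proof. exact: sqrtr_ge0. Qed.

Lemma sqr_enorm p (u : 'cV[R]_p) : enorm u ^+ 2 = dotv u u.
Proof. by rewrite sqr_sqrtr // dotv_ge0. Qed.

Lemma dotv_le_enorm p (u v : 'cV[R]_p) : dotv u v <= enorm u * enorm v.
Proof.
rewrite -sqrtrM ?dotv_ge0 //; apply: le_trans (ler_norm _) _.
by rewrite -sqrtr_sqr ler_wsqrtr // dotv_sqr_le.
Qed.

End Dot.

Lemma continuous_add (K : numFieldType) (T : topologicalType) (f g : T -> K) :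
  continuous f -> continuous g -> continuous (fun x => f x + g x).
Proof. by move=> cf cg x; apply: cvgD; [exact: cf|exact: cg]. Qed.

Lemma continuous_mul (K : numFieldType) (T : topologicalType) (f g : T -> K) :
  continuous f -> continuous g -> continuous (fun x => f x * g x).
Proof. by move=> cf cg x; apply: cvgM; [exact: cf|exact: cg]. Qed.

Lemma continuous_sum (K : numFieldType) (T : topologicalType) (I : Type)
    (r : seq I) (F : I -> T -> K) :
  (forall i, continuous (F i)) -> continuous (fun x => \sum_(i <- r) F i x).
Proof.
move=> hF; elim: r => [|i r IH] x.
  under eq_fun do rewrite big_nil; exact: cvg_cst.
by under eq_fun do rewrite big_cons; apply: continuous_add.
Qed.

(** * Gordan's theorem and separation from the origin *)

Section Separation.
Variables (R : realType) (N : nat).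

(** Nonnegative at [(y, tau)] exactly when [dotv c y] reaches the threshold [tau]; [R^o] is the
    field seen as a vector space over itself. *)
Definition pair_fun (c : 'cV[R]_N) (z : 'cV[R]_N * R^o) : R := dotv c z.1 - z.2.

Lemma pair_fun_linear c : linear_for *%R (pair_fun c).
Proof.
by move=> a x y; rewrite /pair_fun /= dotvDr dotvZr /GRing.scale /=; ring.
Qed.

HB.instance Definition _ c := GRing.isLinear.Build R _ R *%R (pair_fun c) (pair_fun_linear c).

(** If no [y] works, all [(y, tau)] with [dotv y (c i) >= tau] for every [i] have [tau <= 0]. The
    Farkas multipliers of this implication sum to 1, by evaluation at [(0, -1)], and give a
    vanishing convex combination. *)
Lemma gordan (c : nat -> 'cV[R]_N) (r : nat) :
  (forall p : nat -> R, (forall i, 0 <= p i) -> \sum_(i < r) p i = 1 ->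
     \sum_(i < r) p i *: c i != 0) ->
  exists y : 'cV[R]_N, forall i, (i < r)%N -> 0 < dotv y (c i).
Proof.
move=> hc; apply: contrapT => hy.
have [t t0 tE] : exists2 t : nat -> R, (forall i, 0 <= t i)
    & forall z, pair_fun 0 z = \sum_(i < r) t i * pair_fun (c i) z.
  apply: (@farkas R _ (fun i => pair_fun (c i) : {scalar _}) r (pair_fun 0)).
  move=> [y tau] h; change (0 <= pair_fun 0 (y, tau)).
  rewrite /pair_fun dotv0l sub0r oppr_ge0 leNgt /=.
  apply/negP => tau0; apply: hy; exists y => i lti.
  by rewrite dotvC (lt_le_trans tau0) // -subr_ge0; exact: (h i lti).
have t1 : \sum_(i < r) t i = 1.
  have := tE (0, -1); rewrite /pair_fun dotv0r opprK add0r /= => h; rewrite [RHS]h.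
  by apply: eq_bigr => i _; rewrite dotv0r add0r mulr1.
have /eqP := hc t t0 t1; apply.
(* Evaluation at [(s, 0)], with [s] the combination itself, gives [dotv s s = 0]. *)
apply: dotv_eq0; set s := (X in dotv X _).
have := tE (s, 0); rewrite /pair_fun dotv0l !subr0 /= => h.
by rewrite {1}/s dotv_suml [RHS]h; apply: eq_bigr => i _; rewrite dotvZl subr0.
Qed.

(* A family of closed half-spaces [0 <= y . c] is handled on the compact sphere
   of the sup norm, its finite subfamilies by Gordan's theorem. *)
Lemma separation (P : set 'cV[R]_N) : P !=set0 ->
  (forall (r : nat) (c : nat -> 'cV[R]_N) (p : nat -> R),
     (forall i, (i < r)%N -> P (c i)) -> (forall i, 0 <= p i) ->
     \sum_(i < r) p i = 1 -> \sum_(i < r) p i *: c i != 0) ->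
  exists2 y : 'cV[R]_N, y != 0 & forall c, P c -> 0 <= dotv y c.
Proof.
move=> [c0 Pc0] hP.
pose K : set 'rV[R]_N := [set y | `|y| = 1].
have cont (c : 'cV[R]_N) : continuous (fun y : 'rV[R]_N => (y *m c) ord0 ord0 : R).
  rewrite (_ : (fun y => _) = (fun y : 'rV[R]_N => \sum_i y ord0 i * c i ord0)).
    apply: continuous_sum => i; apply: continuous_mul.
      exact: coord_continuous.
    exact: cst_continuous.
  by apply/funext => z; rewrite mxE.
have cK : compact K.
  apply: bounded_closed_compact.
    by exists 1; split => // M M1 y /= ->; apply: ltW.
  rewrite (_ : K = (fun y : 'rV[R]_N => `|y|) @^-1` [set 1 : R]) //.
  apply: closed_comp; last exact: closed_eq.
  by move=> y _; apply: norm_continuous.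
have : \bigcap_(c in P) (K `&` [set y | 0 <= (y *m c) ord0 ord0]) !=set0.
  move: cK; rewrite compact_In0; apply.
    exists (fun c => [set y : 'rV[R]_N | 0 <= (y *m c) ord0 ord0]) => // c _.
    apply: (@closed_comp _ _ _ [set t : R | 0 <= t]); last exact: closed_ge.
    by move=> y _; apply: cont.
  move=> D' D'P.
  (* [c0] makes the list nonempty, so that at least one strict inequality holds and [y] is
     nonzero. *)
  pose s := c0 :: enum_fset D'.
  have sP i : (i < size s)%N -> P (nth 0 s i).
    case: i => [//|i] /=; rewrite ltnS => lti.
    by have /D'P := mem_nth 0 lti; rewrite inE.
  have [y hy] := @gordan (nth 0 s) (size s) (fun p p0 p1 => hP _ _ p sP p0 p1).
  have y0 : y^T != 0.
    apply/eqP => /(congr1 trmx); rewrite trmxK trmx0 => y0.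
    by have := hy 0%N isT; rewrite y0 dotv0l ltxx.
  exists (`|y^T|^-1 *: y^T) => c cD'; split.
    by rewrite /K /= normrZ ger0_norm ?invr_ge0 // mulVf // normr_eq0.
  rewrite /= -scalemxAl mxE mulr_ge0 ?invr_ge0 //; apply: ltW.
  have lti : (index c s < size s)%N by rewrite index_mem inE; apply/orP; right.
  have := hy _ lti; rewrite nth_index //.
  by rewrite inE; apply/orP; right.
move=> [y hy]; exists y^T.
  apply/eqP => /(congr1 trmx); rewrite trmxK trmx0 => y0.
  by have [] := hy _ Pc0; rewrite /K /= y0 normr0 => /esym/eqP; rewrite oner_eq0.
by move=> c /hy[_] /=; rewrite /dotv trmxK.
Qed.

End Separation.

(** * Expectations on compactly supported probabilities *)

Section DiscreteProbability.
Variables (R : realType) (d : measure_display) (T : measurableType d).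
Variables (r : nat) (p : nat -> {nonneg R}) (s : nat -> T).

Definition discrete_measure : {measure set T -> \bar R} :=
  msum (fun i => mscale (p i) (dirac (s i))) r.

Lemma ge0_integral_discrete (f : T -> R) :
  measurable_fun setT f -> (forall x, 0 <= f x) ->
  (\int[discrete_measure]_x (f x)%:E = (\sum_(i < r) (p i)%:num * f (s i))%:E)%E.
Proof.
move=> mf f0.
have mf' : measurable_fun setT (EFin \o f) by exact/measurable_EFinP.
rewrite /discrete_measure ge0_integral_measure_sum //=; last first.
  by move=> x _; rewrite lee_fin.
rewrite -sumEFin; apply: eq_bigr => i _.
rewrite ge0_integral_mscale //; last by move=> x _; rewrite lee_fin.
by rewrite integral_dirac // diracT mul1e.
Qed.

Lemma integral_discrete (f : T -> R) : measurable_fun setT f ->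
  (\int[discrete_measure]_x (f x)%:E = (\sum_(i < r) (p i)%:num * f (s i))%:E)%E.
Proof.
move=> mf; rewrite integralE.
have -> : ((fun x => (f x)%:E)^\+ = (fun x => (Num.max (f x) 0)%:E))%E.
  by apply/funext => x; rewrite unlock -EFin_max.
have -> : ((fun x => (f x)%:E)^\- = (fun x => (Num.max (- f x) 0)%:E))%E.
  by apply/funext => x; rewrite unlock -EFinN -EFin_max.
rewrite !ge0_integral_discrete.
- rewrite -EFinB -sumrB; congr (_%:E); apply: eq_bigr => i _.
  rewrite -mulrBr; congr (_ * _); case: (ltP (f (s i)) 0) => fi.
    by rewrite max_l ?sub0r ?opprK // oppr_ge0 ltW.
  by rewrite max_r ?subr0 // oppr_le0.
- by apply: measurable_maxr => //; exact: measurable_funN.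
- by move=> x; rewrite le_max lexx orbT.
- exact: measurable_maxr.
- by move=> x; rewrite le_max lexx orbT.
Qed.

End DiscreteProbability.

Lemma discrete_probability (R : realType) (d : measure_display)
    (T : measurableType d) (r : nat) (p : nat -> R) (s : nat -> T) :
  (forall i, 0 <= p i) -> \sum_(i < r) p i = 1 ->
  exists F : probability T R,
    forall f : T -> R, measurable_fun setT f ->
      ('E_F[f] = (\sum_(i < r) p i * f (s i))%:E)%E.
Proof.
move=> p0 p1; pose q i := NngNum (p0 i).
have FT : discrete_measure r q s setT = 1%E.
  have := @integral_discrete R d T r q s (cst 1) (measurable_cst _).
  rewrite (integral_cst _ _ 1%E) // mul1e => ->.
  by under eq_bigr do rewrite mulr1; rewrite p1.
pose m := msum (fun i => mscale (q i) (dirac (s i))) r.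
pose F_mixin := Measure_isProbability.Build d T R m FT.
pose F : probability T R := HB.pack m F_mixin.
exists F => f mf; rewrite unlock; exact: integral_discrete.
Qed.

(** * Entrywise continuity of matrix-valued maps *)

Section ContinuousMatrix.
Variables (R : realType) (k : nat).

Definition contmx p q (G : 'cV[R]_k -> 'M[R]_(p, q)) : Prop :=
  forall i j, continuous (fun xi => G xi i j).

Lemma contmx_cst p q (C : 'M[R]_(p, q)) : contmx (fun=> C).
Proof. by move=> i j; apply: cst_continuous. Qed.

Lemma contmx_id : contmx (fun xi => xi).
Proof. by move=> i j; apply: coord_continuous. Qed.

Lemma contmxD p q (G H : 'cV[R]_k -> 'M[R]_(p, q)) :
  contmx G -> contmx H -> contmx (fun xi => G xi + H xi).
Proof.
move=> hG hH i j; rewrite (_ : (fun xi => _) = fun xi => G xi i j + H xi i j).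
  exact: continuous_add (hG i j) (hH i j).
by apply/funext => xi; rewrite mxE.
Qed.

Lemma contmxM p q r (G : 'cV[R]_k -> 'M[R]_(p, q)) (H : 'cV[R]_k -> 'M[R]_(q, r)) :
  contmx G -> contmx H -> contmx (fun xi => G xi *m H xi).
Proof.
move=> hG hH i j.
rewrite (_ : (fun xi => _) = fun xi => \sum_l G xi i l * H xi l j).
  by apply: continuous_sum => l; apply: continuous_mul; [apply: hG|apply: hH].
by apply/funext => xi; rewrite mxE.
Qed.

Lemma contmx_tr p q (G : 'cV[R]_k -> 'M[R]_(p, q)) :
  contmx G -> contmx (fun xi => (G xi)^T).
Proof.
move=> hG i j; rewrite (_ : (fun xi => _) = fun xi => G xi j i); first exact: hG.
by apply/funext => xi; rewrite mxE.
Qed.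

Lemma continuous_dotv p (G H : 'cV[R]_k -> 'cV[R]_p) :
  contmx G -> contmx H -> continuous (fun xi => dotv (G xi) (H xi)).
Proof. by move=> hG hH; apply: contmxM => //; apply: contmx_tr. Qed.

Lemma contmx_affine p (C : 'M[R]_(p, k)) (c : 'cV[R]_p) :
  contmx (fun xi => C *m xi + c).
Proof.
by apply: contmxD; [apply: contmxM; [apply: contmx_cst|apply: contmx_id]|apply: contmx_cst].
Qed.

End ContinuousMatrix.

Section BorelExpectation.
Variables (R : realType) (k : nat).
Local Notation V := (borelV R k).
Implicit Types f g : 'cV[R]_k -> R.

Lemma measurable_open (U : set 'cV[R]_k) : open U -> measurable (U : set V).
Proof. by move=> oU; apply: sub_sigma_algebra. Qed.

Lemma measurable_closed (U : set 'cV[R]_k) : closed U -> measurable (U : set V).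
Proof.
move=> cU; rewrite -[U]setCK; apply: measurableC.
by apply: measurable_open; apply: closed_openC.
Qed.

Lemma measurable_continuous f : continuous f -> measurable_fun setT (f : V -> R).
Proof.
move=> /continuousP cf; apply: (measurability _ (RGenOpens.measurableE R)).
move=> _ [_ [a [b ->] <-]]; rewrite setTI.
by apply: measurable_open; apply: cf; exact: interval_open.
Qed.

End BorelExpectation.

(** * Expectation under a probability carried by a compact set *)

Section CompactSupport.
Variables (R : realType) (k : nat) (S : set 'cV[R]_k).
Variable F : probability (borelV R k) R.
Hypotheses (cS : compact S) (FS : F S = 1%E).
Implicit Types f g : 'cV[R]_k -> R.

Definition mean f : R := fine ('E_F[f])%E.

Lemma measurable_supp : measurable (S : set (borelV R k)).
Proof. by apply: measurable_closed; apply: compact_closed => //; exact: norm_hausdorff. Qed.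

Lemma suppC_eq0 : F (~` S) = 0%E.
Proof.
rewrite (probability_setC _ measurable_supp).
by have -> : F (S : set (borelV R k)) = 1%E := FS; rewrite subee.
Qed.

(** [F] is carried by the compact set [S], on which a continuous function is bounded. *)
Lemma continuous_integrable f : continuous f ->
  F.-integrable setT (EFin \o (f : borelV R k -> R)).
Proof.
move=> cf; have mf := measurable_continuous cf.
have mS := measurable_supp.
apply/(negligible_integrable (measurableC mS)) => //.
- exact/measurable_EFinP.
- exact: suppC_eq0.
rewrite setTD setCK; apply: measurable_bounded_integrable => //.
- by apply: (@le_lt_trans _ _ 1%E); [exact: probability_le1|exact: ltry].
- exact: measurable_funS mf.
have /compact_bounded[M [Mr hM]] : compact (f @` S).
  by apply: continuous_compact => //; exact: continuous_subspaceT.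
by exists M; split=> // N /hM h x Sx; apply: h; exists x.
Qed.

Lemma expectation_mean f : continuous f -> ('E_F[f])%E = (mean f)%:E.
Proof.
move=> cf; rewrite /mean fineK // unlock.
by apply: integrable_fin_num => //; exact: continuous_integrable.
Qed.

Lemma mean_RintegralE f : mean f = \int[F]_x (f x).
Proof. by rewrite /mean unlock. Qed.

Lemma meanD f g : continuous f -> continuous g ->
  mean (fun x => f x + g x) = mean f + mean g.
Proof.
by move=> cf cg; rewrite !mean_RintegralE RintegralD //; exact: continuous_integrable.
Qed.

Lemma meanZ a f : continuous f -> mean (fun x => a * f x) = a * mean f.
Proof.
by move=> cf; rewrite !mean_RintegralE RintegralZl //; exact: continuous_integrable.
Qed.

Lemma mean_cst a : mean (fun=> a) = a.
Proof. by rewrite /mean (expectation_cst F a). Qed.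

Lemma mean_sum (I : Type) (r : seq I) (G : I -> 'cV[R]_k -> R) :
  (forall i, continuous (G i)) ->
  mean (fun x => \sum_(i <- r) G i x) = \sum_(i <- r) mean (G i).
Proof.
move=> cG; elim: r => [|i r IH].
  by rewrite big_nil -[RHS](mean_cst 0); congr mean; apply/funext => x; rewrite big_nil.
rewrite big_cons -IH -meanD //; last exact: continuous_sum.
by congr mean; apply/funext => x; rewrite big_cons.
Qed.

Lemma mean_le f g : continuous f -> continuous g ->
  (forall x, S x -> f x <= g x) -> mean f <= mean g.
Proof.
move=> cf cg fg; rewrite !mean_RintegralE /Rintegral.
have mS := measurable_supp.
rewrite !(negligible_integral (measurableC mS) measurableT _ suppC_eq0) ?setTD ?setCK;
  [|exact: continuous_integrable..].
apply: le_Rintegral => //.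
  apply: integrableS (continuous_integrable cf) => //.
apply: integrableS (continuous_integrable cg) => //.
Qed.

End CompactSupport.

(** * Positive semidefinite matrices *)

Section PSD.
Variables (R : realType) (k : nat).
Implicit Types (Q Z : 'M[R]_k) (u v x y : 'cV[R]_k).

Lemma frobE p q (X Y : 'M[R]_(p, q)) : frob X Y = \sum_j \sum_i X i j * Y i j.
Proof.
rewrite /frob /mxtrace; apply: eq_bigr => j _; rewrite mxE.
by apply: eq_bigr => i _; rewrite mxE.
Qed.

Lemma frobC p q (X Y : 'M[R]_(p, q)) : frob X Y = frob Y X.
Proof. by rewrite !frobE; do 2!(apply: eq_bigr => ? _); rewrite mulrC. Qed.

Lemma frobDr p q (X Y Z : 'M[R]_(p, q)) :
  frob X (Y + Z) = frob X Y + frob X Z.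
Proof. by rewrite /frob mulmxDr mxtraceD. Qed.

Lemma frobNr p q (X Y : 'M[R]_(p, q)) : frob X (- Y) = - frob X Y.
Proof. by rewrite /frob mulmxN linearN. Qed.

Lemma frobBr p q (X Y Z : 'M[R]_(p, q)) : frob X (Y - Z) = frob X Y - frob X Z.
Proof. by rewrite frobDr frobNr. Qed.

Lemma frobZr p q (X Y : 'M[R]_(p, q)) a : frob X (a *: Y) = a * frob X Y.
Proof. by rewrite /frob -scalemxAr mxtraceZ. Qed.

Lemma frob0r p q (X : 'M[R]_(p, q)) : frob X 0 = 0.
Proof. by rewrite /frob mulmx0 mxtrace0. Qed.

Lemma frobDl p q (X Y Z : 'M[R]_(p, q)) : frob (Y + Z) X = frob Y X + frob Z X.
Proof. by rewrite frobC frobDr !(frobC X). Qed.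

Lemma frobNl p q (X Y : 'M[R]_(p, q)) : frob (- Y) X = - frob Y X.
Proof. by rewrite frobC frobNr frobC. Qed.

Lemma frobZl p q (X Y : 'M[R]_(p, q)) a : frob (a *: Y) X = a * frob Y X.
Proof. by rewrite frobC frobZr frobC. Qed.

Lemma frob_suml p q (I : Type) (r : seq I) (P : pred I) (G : I -> 'M[R]_(p, q)) X :
  frob (\sum_(i <- r | P i) G i) X = \sum_(i <- r | P i) frob (G i) X.
Proof.
by rewrite /frob linear_sum mulmx_suml linear_sum.
Qed.

Lemma frob_outer p q (a : 'cV[R]_p) (c : 'cV[R]_q) (Q : 'M[R]_(p, q)) :
  frob (a *m c^T) Q = dotv a (Q *m c).
Proof.
rewrite /frob trmx_mul trmxK -mulmxA mxtrace_mulC -mulmxA /mxtrace big_ord1.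
by rewrite /dotv mulmxA.
Qed.

(** Vectorization carries the trace product to the dot product, so that a block of a separating
    vector can be read as a matrix. *)
Lemma frob_mxvec p q (X Y : 'M[R]_(p, q)) :
  dotv (mxvec X)^T (mxvec Y)^T = frob X Y.
Proof.
rewrite dotvE frobE exchange_big /= pair_bigA /=.
rewrite (reindex (uncurry (@mxvec_index p q))) /=; last first.
  exact: curry_mxvec_bij.
by apply: eq_bigr => -[i j] _; rewrite !mxE !mxvecE.
Qed.

Lemma dotv_formD Q x y : symmx Q ->
  dotv (x + y) (Q *m (x + y)) = dotv x (Q *m x) + 2 * dotv x (Q *m y) + dotv y (Q *m y).
Proof.
move=> sQ; rewrite mulmxDr dotvDl !dotvDr.
have -> : dotv y (Q *m x) = dotv x (Q *m y) by rewrite dotv_mulmx sQ dotvC.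
ring.
Qed.

(** The form at [x + t *: y] is a nonnegative polynomial in [t]; its value at the minimizer
    [- a / c] gives the inequality. *)
Lemma psd_cauchy Q x y : psdmx Q ->
  dotv x (Q *m y) ^+ 2 <= dotv x (Q *m x) * dotv y (Q *m y).
Proof.
move=> [sQ pQ].
have yx : dotv y (Q *m x) = dotv x (Q *m y) by rewrite dotv_mulmx sQ dotvC.
set a := dotv x (Q *m y); set c := dotv y (Q *m y).
have key t : 0 <= dotv x (Q *m x) + 2 * t * a + t ^+ 2 * c.
  have := pQ (x + t *: y); rewrite dotv_formD // -scalemxAr !dotvZr dotvZl -/a -/c.
  by move=> h; apply: le_trans h _; rewrite le_eqVlt; apply/orP; left; apply/eqP; ring.
have [c0|c0] := eqVneq c 0.
  have [->|a0] := eqVneq a 0; first by rewrite expr0n c0 mulr0.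
  (* For [c = 0] the polynomial is affine in [t], and this [t] would bring it down to -1. *)
  have := key (- (dotv x (Q *m x) + 1) / (2 * a)).
  rewrite c0 mulr0 addr0 (_ : 2 * _ * a = - (dotv x (Q *m x) + 1)); last by field.
  by lra.
have cgt0 : 0 < c by rewrite lt_def c0 pQ.
have := key (- a / c).
rewrite (_ : _ + _ = (dotv x (Q *m x) * c - a ^+ 2) / c); last by field.
by rewrite pmulr_lge0 ?invr_gt0 // subr_ge0.
Qed.

Lemma psd_zero Q x : psdmx Q -> dotv x (Q *m x) = 0 -> Q *m x = 0.
Proof.
move=> hQ hx; apply: dotv_eq0; apply/eqP; rewrite -sqrf_eq0 eq_le sqr_ge0 andbT.
by have := psd_cauchy (Q *m x) x hQ; rewrite hx mulr0.
Qed.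

(** A Schur complement: at [x] the form drops by [(x' Q e_i)^2 / Q i i], which Cauchy-Schwarz bounds
    by [x' Q x]. *)
Lemma psd_sub_rank1 Q i : psdmx Q -> 0 < Q i i ->
  psdmx (Q - (Q i i)^-1 *: (col i Q *m (col i Q)^T)).
Proof.
move=> hQ qi; have [sQ pQ] := hQ; split.
  by rewrite /symmx linearB linearZ /= trmx_mul trmxK sQ.
have colE : col i Q = Q *m delta_mx i ord0 by rewrite colE.
have Qii : dotv (delta_mx i ord0) (Q *m delta_mx i ord0) = Q i i.
  by rewrite dotv_delta -colE mxE.
move=> x; rewrite mulmxBl dotvBr -scalemxAl dotvZr.
have -> : dotv x (col i Q *m (col i Q)^T *m x) = dotv x (Q *m delta_mx i ord0) ^+ 2.
  rewrite -mulmxA [(col i Q)^T *m x]mx11_scalar -/(dotv _ _) mul_mx_scalar dotvZr.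
  by rewrite colE dotvC expr2.
rewrite subr_ge0 mulrC ler_pdivrMr //.
by have := psd_cauchy x (delta_mx i ord0) hQ; rewrite Qii.
Qed.

(* Symmetric Gaussian elimination: each step clears one more row. *)
Lemma psd_sum_rank1 Q : psdmx Q ->
  exists s : seq 'cV[R]_k, Q = \sum_(v <- s) v *m v^T.
Proof.
have [n] := ubnP #|[pred i | row i Q != 0]|; elim: n Q => // n IH Q.
rewrite ltnS => hn hQ; have [sQ pQ] := hQ.
have sQE i j : Q i j = Q j i by rewrite -{1}sQ mxE.
case: (pickP (fun i => row i Q != 0)) => [i ri|r0]; last first.
  exists [::]; rewrite big_nil; apply/row_matrixP => i; rewrite row0.
  by apply/eqP; move: (r0 i) => /negbFE.
have Qe : dotv (delta_mx i ord0) (Q *m delta_mx i ord0) = Q i i.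
  by rewrite dotv_delta -colE mxE.
have qi : 0 < Q i i.
  rewrite lt_def -{2}Qe pQ andbT; apply: contra ri => /eqP qi0.
  have := psd_zero hQ (etrans Qe qi0); rewrite -colE => /colP h.
  by apply/eqP/rowP => j; rewrite !mxE sQE; have := h j; rewrite !mxE.
pose Q' := Q - (Q i i)^-1 *: (col i Q *m (col i Q)^T).
have hQ' : psdmx Q' by exact: psd_sub_rank1.
have Q'E a c : Q' a c = Q a c - (Q i i)^-1 * (Q a i * Q c i).
  by rewrite /Q' !mxE big_ord1 !mxE.
have [|s sE] := IH Q' _ hQ'.
  apply: leq_trans hn; apply: proper_card; apply/properP; split.
    apply/fintype.subsetP => j; rewrite !inE; apply: contra => /eqP /rowP rj.
    have Qj c : Q j c = 0 by have := rj c; rewrite !mxE.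
    by apply/eqP/rowP => c; rewrite [LHS]mxE [RHS]mxE Q'E !Qj mul0r mulr0 subr0.
  exists i; rewrite !inE // negbK; apply/eqP/rowP => c.
  by rewrite [LHS]mxE [RHS]mxE Q'E (sQE c i) mulrA mulVf ?mul1r ?subrr // gt_eqF.
exists (Num.sqrt (Q i i)^-1 *: col i Q :: s).
rewrite big_cons -sE /Q' linearZ /= -scalemxAl -scalemxAr scalerA -expr2.
by rewrite sqr_sqrtr ?invr_ge0 ?(ltW qi) // addrC subrK.
Qed.

(** Writing [Q] as a sum of [v *m v^T] turns the trace product into a sum of values of the form of
    [Z]. *)
Lemma frob_psd_ge0 Q Z : psdmx Q ->
  (forall u, 0 <= dotv u (Z *m u)) -> 0 <= frob Q Z.
Proof.
move=> /psd_sum_rank1[s ->] hZ; rewrite frob_suml sumr_ge0 // => v _.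
by rewrite frob_outer.
Qed.

Lemma frob_pd_eq0 Q Z : psdmx Q -> pdmx Z -> frob Q Z = 0 -> Q = 0.
Proof.
move=> /psd_sum_rank1[s ->] [_ pZ]; rewrite frob_suml.
have Zge0 u : 0 <= dotv u (Z *m u).
  by have [->|/pZ /ltW//] := eqVneq u 0; rewrite dotv0l.
under eq_bigr do rewrite frob_outer.
move/eqP; rewrite psumr_eq0 // => /allP h.
rewrite big_seq big1 // => v /h /= /eqP v0.
have [->|/pZ] := eqVneq v 0; first by rewrite mul0mx.
by rewrite v0 ltxx.
Qed.

Lemma pd_psd Z : pdmx Z -> psdmx Z.
Proof.
move=> [sZ pZ]; split=> // u.
by have [->|/pZ /ltW//] := eqVneq u 0; rewrite dotv0l.
Qed.

Lemma pd_unitmx Z : pdmx Z -> Z \in unitmx.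
Proof.
move=> [sZ pZ]; rewrite -row_free_unit -kermx_eq0; apply/negP => /negP.
move=> /rowV0Pn[u]; rewrite sub_kermx => /eqP uZ u0.
have := pZ u^T; rewrite /dotv trmxK mulmxA uZ mul0mx mxE ltxx => h.
suff : false by []; apply: h; apply: contra u0 => /eqP /(congr1 trmx).
by rewrite trmxK trmx0 => ->.
Qed.

End PSD.

(** * The support function of an ellipsoid *)

Section Ellipsoid.
Variables (R : realType) (k : nat) (Sigma Sh : 'M[R]_k) (gamma : R).
Hypotheses (pdS : pdmx Sigma) (sqS : is_sqrtmx Sigma Sh) (g0 : 0 <= gamma).

Definition ellipsoid : set 'cV[R]_k :=
  [set e | dotv e (invmx Sigma *m e) <= gamma].

Lemma sqrtmx_unit : Sh \in unitmx.
Proof.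
have := pd_unitmx pdS; have [_ <-] := sqS.
by rewrite unitmx_mul => /andP[].
Qed.

Lemma dotv_inv_sqrtmx u : dotv (Sh *m u) (invmx Sigma *m (Sh *m u)) = dotv u u.
Proof.
have [[sSh _] SS] := sqS; have uS := sqrtmx_unit.
have -> : invmx Sigma *m (Sh *m u) = invmx Sh *m u.
  rewrite -{1}(mulKVmx uS u) (mulmxA Sh Sh) SS mulKmx //; exact: pd_unitmx.
by rewrite dotvC dotv_mulmx sSh mulKVmx.
Qed.

(** Write [e] as [Sh *m u] with [dotv u u <= gamma], move [Sh] onto [v] and apply Cauchy-Schwarz. *)
Lemma dotv_ellipsoid_le v e : ellipsoid e ->
  dotv v e <= Num.sqrt gamma * enorm (Sh *m v).
Proof.
have [[sSh _] SS] := sqS; have uS := sqrtmx_unit.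
rewrite -(mulKVmx uS e); set u := invmx Sh *m e.
rewrite /ellipsoid /= dotv_inv_sqrtmx => hu.
rewrite dotv_mulmx sSh; apply: le_trans (dotv_le_enorm _ _) _.
by rewrite mulrC ler_wpM2r ?enorm_ge0 // ler_wsqrtr.
Qed.

(** The minimizer is a negative multiple of [Sigma v] scaled to the boundary; the centre serves when
    [Sh *m v] is zero. *)
Lemma dotv_ellipsoid_attained v : exists2 e, ellipsoid e &
  dotv v e = - (Num.sqrt gamma * enorm (Sh *m v)).
Proof.
have [[sSh _] SS] := sqS.
have [n0|n0] := eqVneq (enorm (Sh *m v)) 0.
  exists 0; first by rewrite /ellipsoid /= dotv0l.
  by rewrite dotv0r n0 mulr0 oppr0.
set c := - (Num.sqrt gamma / enorm (Sh *m v)).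
exists (c *: (Sh *m (Sh *m v))).
  rewrite /ellipsoid /= -scalemxAr dotvZl dotvZr dotv_inv_sqrtmx -sqr_enorm mulrA.
  rewrite -expr2 -exprMn /c mulNr divfK // sqrrN sqr_sqrtr //.
rewrite dotvZr dotv_mulmx sSh -sqr_enorm /c; field; exact: n0.
Qed.

End Ellipsoid.

(** * Support and ambiguity set *)

Lemma mulmx_row_dotv (R : realType) p q (P : 'M[R]_(p, q)) i (u : 'cV[R]_q) :
  (P *m u) i ord0 = dotv (row i P)^T u.
Proof. by rewrite /dotv trmxK -row_mul [RHS]mxE. Qed.

Section Support.
Variables (R : realType) (d m n k l : nat) (D : data R d m n k l).
Hypotheses (hS : compact (supp D))
  (hemp : empirical_moments (supp D) (mu0 D) (Sigma0 D))
  (hSigma : pdmx (Sigma0 D)).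
Local Notation S := (supp D).

Lemma suppE xi : S xi <-> forall i, h D i ord0 <= (W D *m xi) i ord0.
Proof. by split => [hx i //|hx i j]; rewrite ord1. Qed.

Lemma supp_mu0 : S (mu0 D).
Proof.
have [N [s [N0 sS muE _]]] := hemp; apply/suppE => i.
have N0' : 0 < N%:R :> R by rewrite ltr0n.
rewrite mulmx_row_dotv muE dotvZr dotv_sumr mulrC ler_pdivlMr //.
rewrite mulr_natr -[in leLHS](card_ord N) -sumr_const; apply: ler_sum => j _.
by rewrite -mulmx_row_dotv; move/suppE: (sS j).
Qed.

(* A face of the support through the empirical mean contains the whole sample,
   which is impossible when the empirical covariance is nonsingular. *)
Lemma supp_mu0_slack (i : 'I_l) :
  h D i ord0 < (W D *m mu0 D) i ord0 \/ row i (W D) = 0.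
Proof.
have [N [s [N0 sS muE SE]]] := hemp.
have N0' : N%:R != 0 :> R by rewrite pnatr_eq0 -lt0n.
have [->|hlt] := eqVneq (row i (W D)) 0; [by right|left].
rewrite lt_neqAle (proj1 (suppE _) supp_mu0) andbT eq_sym.
apply: contra hlt => /eqP hi; apply/eqP; apply: trmx_inj; rewrite trmx0.
set a := (row i (W D))^T.
have aE xi : (W D *m xi) i ord0 = dotv a xi by exact: mulmx_row_dotv.
have asum : \sum_j dotv a (s j - mu0 D) = 0.
  rewrite -dotv_sumr sumrB sumr_const card_ord (_ : \sum_j s j = N%:R *: mu0 D).
    by rewrite scaler_nat subrr dotv0r.
  by rewrite muE scalerA mulfV // scale1r.
have a0 j : dotv a (s j - mu0 D) = 0.
  have : \sum_j dotv a (s j - mu0 D) == 0 by rewrite asum.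
  rewrite psumr_eq0 => [|j' _].
    by move=> /allP /(_ j (mem_index_enum _)) /eqP.
  by rewrite dotvBr -!aE hi subr_ge0; exact: (proj1 (suppE _) (sS j')).
have Sa : (\sum_(j < N) (s j - mu0 D) *m (s j - mu0 D)^T) *m a = 0.
  rewrite mulmx_suml big1 // => j _.
  by rewrite -mulmxA [_^T *m a]mx11_scalar -/(dotv _ _) dotvC a0 mul_mx_scalar scale0r.
apply/eqP; apply: contraT => an0.
have [_ /(_ a an0)] := hSigma.
by case: SE => ->; rewrite -scalemxAl Sa scaler0 dotv0r ltxx.
Qed.

(** Constraints with a nonzero row are strict at [mu0], and those with a zero row are unaffected by
    any move. *)
Lemma supp_mu0_interior (v : 'cV[R]_k) :
  exists2 e : R, 0 < e & S (mu0 D + e *: v).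
Proof.
pose b i := (W D *m mu0 D) i ord0 - h D i ord0.
(* The smallest ratio of slack to change; adding 1 keeps the denominators positive, and the default
   1 covers the case of no nonzero row. *)
pose e := \big[Num.min/1]_(i < l | row i (W D) != 0) (b i / (`|(W D *m v) i ord0| + 1)).
have den i : 0 < `|(W D *m v) i ord0| + 1 by rewrite ltr_wpDl.
have e0 : 0 < e.
  rewrite /e; apply: lt_bigmin => // i ri; rewrite divr_gt0 // subr_gt0.
  by case: (supp_mu0_slack i) => // r0; rewrite r0 eqxx in ri.
exists e => //; apply/suppE => i; rewrite mulmxDr mxE -scalemxAr [X in _ + X]mxE.
have [r0|ri] := eqVneq (row i (W D)) 0.
  rewrite !mulmx_row_dotv r0 trmx0 !dotv0l mulr0 addr0.
  by have := proj1 (suppE _) supp_mu0 i; rewrite mulmx_row_dotv r0 trmx0 dotv0l.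
have : e <= b i / (`|(W D *m v) i ord0| + 1) by exact: bigmin_le_cond.
rewrite ler_pdivlMr // => he.
have h1 : - (e * (W D *m v) i ord0) <= e * (`|(W D *m v) i ord0| + 1).
  rewrite -mulrN ler_pM2l //; apply: le_trans (ler_norm _) _.
  by rewrite normrN lerDl.
by have := le_trans h1 he; rewrite /b; lra.
Qed.

Lemma supp_bounded : exists2 K : R, 0 <= K & forall xi, S xi -> `|xi| <= K.
Proof.
have [K [_ hK]] := compact_bounded hS.
exists (`|K| + 1); first by rewrite addr_ge0.
by move=> xi Sxi; apply: hK => //; rewrite ltr_pwDr // ler_norm.
Qed.

(** A nonempty bounded polyhedron has no nonzero recession direction: [t] below gives [t *: z] the
    norm [K + |mu0| + 1]. *)
Lemma supp_recession (z : 'cV[R]_k) : mxle 0 (W D *m z) -> z = 0.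
Proof.
move=> hz; have [K K0 hK] := supp_bounded.
apply/eqP; rewrite -normr_eq0; apply/negPn/negP => z0.
have zgt0 : 0 < `|z| by rewrite lt_def z0 /=.
pose t := (K + `|mu0 D| + 1) / `|z|.
have t0 : 0 <= t by rewrite divr_ge0 // !addr_ge0.
have : S (mu0 D + t *: z).
  apply/suppE => i; rewrite mulmxDr mxE -scalemxAr [X in _ + X]mxE.
  have := hz i ord0; rewrite mxE => hzi; have hi := proj1 (suppE _) supp_mu0 i.
  by apply: le_trans hi _; rewrite lerDl mulr_ge0.
move=> /hK; apply/negP; rewrite -ltNge.
have : `|t *: z| <= `|mu0 D + t *: z| + `|mu0 D|.
  by rewrite -[X in `|X| <= _](addKr (mu0 D)) addrC; apply: le_trans (ler_normD _ _) _; rewrite normrN.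
rewrite normrZ ger0_norm // /t divfK //; lra.
Qed.

Lemma supp_affine_eq0 (p : nat) (G : 'M[R]_(p, k)) (g : 'cV[R]_p) :
  (forall xi, S xi -> G *m xi + g = 0) -> G = 0 /\ g = 0.
Proof.
move=> hG; have h0 := hG _ supp_mu0.
have Gv (v : 'cV[R]_k) : G *m v = 0.
  have [e e0 /hG] := supp_mu0_interior v.
  rewrite mulmxDr addrAC h0 add0r -scalemxAr => /eqP.
  by rewrite scaler_eq0 gt_eqF //= => /eqP.
have G0 : G = 0.
  by apply/matrixP => i j; have := Gv (delta_mx j ord0); rewrite -colE => /colP /(_ i); rewrite !mxE.
by split=> //; move: h0; rewrite G0 mul0mx add0r.
Qed.

(** For [t > 0] divide by [t]. For [t <= 0] the difference [z - t *: mu0] is a recession direction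
    of the support, hence zero. *)
Lemma supp_homogenize (z : 'cV[R]_k) (t : R) :
  (forall i, h D i ord0 * t <= (W D *m z) i ord0) ->
  exists2 xi, S xi & z = t *: xi.
Proof.
move=> hz; have [t0|t0] := ltP 0 t.
  exists (t^-1 *: z); last by rewrite scalerA mulfV ?scale1r // gt_eqF.
  apply/suppE => i; rewrite -scalemxAr mxE mulrC ler_pdivlMr //.
exists (mu0 D); first exact: supp_mu0.
apply/eqP; rewrite -subr_eq0; apply/eqP; apply: supp_recession => i j.
rewrite ord1 mxE mulmxBr mxE [X in _ + X]mxE -scalemxAr [X in _ - X]mxE.
have hi := proj1 (suppE _) supp_mu0 i; have := hz i.
by have := ler_wnM2l t0 hi; lra.
Qed.

Definition affine_fun (a : 'cV[R]_k) (b : R) (z : 'cV[R]_k * R^o) : R :=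
  dotv a z.1 + b * z.2.

Lemma affine_fun_linear a b : linear_for *%R (affine_fun a b).
Proof.
by move=> c x y; rewrite /affine_fun /= dotvDr dotvZr /GRing.scale /=; ring.
Qed.

HB.instance Definition _ a b :=
  GRing.isLinear.Build R _ R *%R (affine_fun a b) (affine_fun_linear a b).

(** Farkas' lemma for the homogenized system in [(z, s)], made of the rows of [W z - h s] together
    with [s] itself. *)
Lemma affine_farkas (a : 'cV[R]_k) (b : R) :
  (forall xi, S xi -> 0 <= dotv a xi + b) ->
  exists t : 'cV[R]_l, [/\ mxle 0 t, (W D)^T *m t = a & 0 <= dotv t (h D) + b].
Proof.
move=> hab.
(* Index [l], where [insub] fails, carries the constraint [0 <= s]. *)
pose L (i : nat) : {scalar ('cV[R]_k * R^o)%type} :=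
  if insub i is Some j then affine_fun (row j (W D))^T (- h D j ord0)
  else affine_fun 0 1.
have Lj (j : 'I_l) z : L j z = (W D *m z.1) j ord0 - h D j ord0 * z.2.
  by rewrite /L valK mulmx_row_dotv -mulNr.
have Ll z : L l z = z.2.
  rewrite /L insubF ?ltnn //; change (affine_fun 0 1 z = z.2).
  by rewrite /affine_fun dotv0l add0r mul1r.
have [t t0 tE] : exists2 t : nat -> R, (forall i, 0 <= t i)
    & forall z, affine_fun a b z = \sum_(i < l.+1) t i * L i z.
  apply: (@farkas R _ L l.+1 (affine_fun a b)) => -[z s] hz.
  have s0 : 0 <= s by have := hz l (ltnSn l); rewrite Ll.
  have [xi Sxi ->] : exists2 xi, S xi & z = s *: xi.
    apply: supp_homogenize => i.
    by have := hz i (ltnW (ltn_ord i)); rewrite Lj subr_ge0.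
  change (0 <= affine_fun a b (s *: xi, s)).
  rewrite /affine_fun /= dotvZr (mulrC b) -mulrDr mulr_ge0 //; exact: hab.
pose tv : 'cV[R]_l := \col_i t i.
have tE' z : affine_fun a b z = dotv tv (W D *m z.1) - dotv tv (h D) * z.2 + t l * z.2.
  rewrite tE big_ord_recr /= Ll !dotvE mulr_suml -sumrB; congr (_ + _).
  by apply: eq_bigr => i _; rewrite Lj !mxE; ring.
exists tv; split.
- by move=> i j; rewrite !mxE.
- apply/colP => i; have := tE' (delta_mx i ord0, 0).
  rewrite /affine_fun /= !mulr0 !addr0 subr0 dotv_mulmx !(dotvC _ (delta_mx _ _)).
  by rewrite !dotv_delta => ->.
(* The quantity to be shown nonnegative is the multiplier [t l]. *)
- have := tE' (0, 1); rewrite /affine_fun /= mulmx0 !dotv0r !mulr1 !add0r => ->.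
  by rewrite addrA subrr add0r.
Qed.

Lemma affine_farkas_mx (p : nat) (P : 'M[R]_(p, k)) (p0 : 'cV[R]_p) :
  (forall xi, S xi -> mxle 0 (P *m xi + p0)) ->
  exists T : 'M[R]_(p, l), [/\ mxle 0 T, T *m W D = P & mxle 0 (T *m h D + p0)].
Proof.
move=> hP.
have /choice[t ht] : forall i : 'I_p, exists t : 'cV[R]_l,
    [/\ mxle 0 t, (W D)^T *m t = (row i P)^T & 0 <= dotv t (h D) + p0 i ord0].
  move=> i; apply: affine_farkas => xi /hP /(_ i ord0).
  by rewrite mxE [X in _ <= X]mxE mulmx_row_dotv.
have rowE i : row i (\matrix_(a, j) t a j ord0) = (t i)^T.
  by apply/rowP => j; rewrite !mxE.
exists (\matrix_(a, j) t a j ord0); split.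
- by move=> i j; rewrite !mxE; have [/(_ j ord0)] := ht i; rewrite mxE.
- apply/row_matrixP => i; rewrite row_mul rowE; apply: trmx_inj.
  by rewrite trmx_mul trmxK; have [_ ->] := ht i.
- move=> i j; rewrite ord1 mxE [X in _ <= X]mxE mulmx_row_dotv rowE trmxK.
  by have [_ _] := ht i.
Qed.

End Support.

(** * Members of the ambiguity set and weak duality *)

Section Ambiguity.
Variables (R : realType) (d m n k l : nat) (D : data R d m n k l) (Sh : 'M[R]_k).
Hypotheses (hS : compact (supp D))
  (hemp : empirical_moments (supp D) (mu0 D) (Sigma0 D))
  (hSigma : pdmx (Sigma0 D))
  (hSh : is_sqrtmx (Sigma0 D) Sh)
  (hgamma1 : 0 <= gamma1 D)
  (hgamma2 : 1 <= gamma2 D).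
Local Notation S := (supp D).
Local Notation eta xi := (xi - mu0 D).

Lemma continuous_outer i j :
  continuous (fun xi : 'cV[R]_k => (eta xi *m (eta xi)^T) i j).
Proof.
have cc : contmx (fun xi : 'cV[R]_k => eta xi).
  by apply: contmxD; [apply: contmx_id|apply: contmx_cst].
by apply: contmxM => //; apply: contmx_tr.
Qed.

Lemma discrete_DM (r : nat) (p : nat -> R) (s : nat -> 'cV[R]_k) :
  (forall i, 0 <= p i) -> \sum_(i < r) p i = 1 -> (forall i, S (s i)) ->
  ellipsoid (Sigma0 D) (gamma1 D) (\sum_(i < r) p i *: eta (s i)) ->
  (forall u, 0 <= dotv u ((gamma2 D *: Sigma0 D
     - \sum_(i < r) p i *: (eta (s i) *m (eta (s i))^T)) *m u)) ->
  exists2 F : probability (borelV R k) R, DM D F &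
    forall f : borelV R k -> R, measurable_fun setT f ->
      ('E_F[f] = (\sum_(i < r) p i * f (s i))%:E)%E.
Proof.
move=> p0 p1 sS hell hpsd.
have [F FE] := @discrete_probability R _ (borelV R k) r p s p0 p1.
exists F => //.
have Ec (f : 'cV[R]_k -> R) : continuous f -> ('E_F[f] = (\sum_(i < r) p i * f (s i))%:E)%E.
  by move=> cf; apply: FE; exact: measurable_continuous.
have meanE : meanV F - mu0 D = \sum_(i < r) p i *: eta (s i).
  under [in RHS]eq_bigr do rewrite scalerBr.
  rewrite sumrB -scaler_suml p1 scale1r; congr (_ - _).
  apply/colP => i; rewrite mxE Ec /=; last exact: coord_continuous.
  by rewrite summxE; apply: eq_bigr => j _; rewrite mxE.
have csmE : centered_second_moment F (mu0 D) =
    \sum_(i < r) p i *: (eta (s i) *m (eta (s i))^T).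
  apply/matrixP => i j; rewrite mxE Ec /=; last exact: continuous_outer.
  by rewrite summxE; apply: eq_bigr => a _; rewrite [RHS]mxE.
split.
- have mS := measurable_supp hS.
  rewrite -[LHS](expectation_indic F mS) FE; last exact: measurable_indic.
  congr (_%:E); rewrite -p1; apply: eq_bigr => i _.
  by rewrite indicE mem_set ?mulr1.
- by rewrite meanE.
- split; last by rewrite csmE.
  have [sSig _] := hSigma.
  rewrite /symmx csmE linearB linearZ /= sSig linear_sum /=; congr (_ - _).
  by apply: eq_bigr => i _; rewrite linearZ /= trmx_mul trmxK.
Qed.

(* The three atoms mu0, xi and a point of S opposite to xi balance the mean; a
   small total weight away from mu0 keeps the second moment below Sigma0. *)
Lemma DM_atom (xi : 'cV[R]_k) : S xi ->
  exists2 F : probability (borelV R k) R, DM D F &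
    exists2 c : R, 0 < c & forall U : set (borelV R k), measurable U -> U xi ->
      (c%:E <= F U)%E.
Proof.
move=> Sxi; have [e e0 Se] := supp_mu0_interior hemp hSigma (- eta xi).
have uS := sqrtmx_unit hSigma hSh.
have [[sSh _] SS] := hSh.
set w := invmx Sh *m eta xi.
(* [dotv w w] is the squared length of [eta xi] in the metric of [invmx (Sigma0 D)]; this weight
   makes [ep * e * dotv w w <= 1], which bounds the second moment by [Sigma0]. *)
pose ep := (1 + e * dotv w w)^-1.
have den : 0 < 1 + e * dotv w w by rewrite ltr_pwDl // mulr_ge0 ?dotv_ge0 ?ltW.
have ep0 : 0 < ep by rewrite invr_gt0.
have ep1 : ep <= 1.
  by rewrite invf_le1 // lerDl mulr_ge0 ?dotv_ge0 ?ltW.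
have e1 : 0 < 1 + e by rewrite addr_gt0.
(* The weights [e / (1 + e)] and [1 / (1 + e)] balance [eta xi] against [- e *: eta xi]. Beyond the
   lists the defaults are a point of the support and a zero weight. *)
pose s i := nth (mu0 D) [:: mu0 D; xi; mu0 D + e *: - eta xi] i.
pose p i := nth 0 [:: 1 - ep; ep * (e / (1 + e)); ep * (1 + e)^-1] i.
have p0 i : 0 <= p i.
  case: i => [|[|[|i]]]; rewrite /p /= ?nth_nil ?subr_ge0 //.
    by rewrite mulr_ge0 ?divr_ge0 // ltW.
  by rewrite mulr_ge0 ?invr_ge0 // ltW.
have sS i : S (s i).
  by case: i => [|[|[|i]]]; rewrite /s /= ?nth_nil //; exact: supp_mu0.
have eta0 : eta (mu0 D) = 0 by rewrite subrr.
have eta2 : eta (mu0 D + e *: - eta xi) = (- e) *: eta xi.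
  by rewrite addrC addKr scalerN scaleNr.
have p1 : \sum_(i < 3) p i = 1.
  by rewrite !big_ord_recl big_ord0 /p /= /bump /=; field; rewrite gt_eqF.
have m1 : \sum_(i < 3) p i *: eta (s i) = 0.
  rewrite !big_ord_recl big_ord0 /s /p /= /bump /= eta0 eta2 scaler0 add0r addr0.
  rewrite scalerA -scalerDl (_ : _ + _ = 0) ?scale0r //; field; by rewrite gt_eqF.
have m2 : \sum_(i < 3) p i *: (eta (s i) *m (eta (s i))^T)
    = (ep * e) *: (eta xi *m (eta xi)^T).
  rewrite !big_ord_recl big_ord0 /s /p /= /bump /= eta0 eta2 mul0mx scaler0 add0r addr0.
  rewrite linearZ /= -scalemxAl -scalemxAr !scalerA -scalerDl; congr (_ *: _).
  by field; rewrite gt_eqF.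
have [|u|F hF FE] := @discrete_DM 3 p s p0 p1 sS.
- by rewrite m1 /ellipsoid /= dotv0l.
- rewrite m2 mulmxBl dotvBr -!scalemxAl !dotvZr.
  have -> : dotv u (eta xi *m (eta xi)^T *m u) = dotv u (eta xi) ^+ 2.
    by rewrite -mulmxA [_^T *m u]mx11_scalar -/(dotv _ _) mul_mx_scalar dotvZr dotvC expr2.
  have SigE : dotv u (Sigma0 D *m u) = dotv (Sh *m u) (Sh *m u).
    by rewrite -SS -mulmxA dotv_mulmx sSh.
  have h1 : dotv u (eta xi) ^+ 2 <= dotv (Sh *m u) (Sh *m u) * dotv w w.
    rewrite -{1}(mulKVmx uS (eta xi)) -/w (dotv_mulmx Sh u w) sSh.
    exact: dotv_sqr_le.
  have U0 := dotv_ge0 (Sh *m u).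
  have h2 : ep * e * (dotv (Sh *m u) (Sh *m u) * dotv w w) <= dotv (Sh *m u) (Sh *m u).
    rewrite (_ : ep * e * _ = dotv (Sh *m u) (Sh *m u) * (e * dotv w w) / (1 + e * dotv w w)).
      by rewrite ler_pdivrMr // ler_wpM2l // lerDr.
    by rewrite /ep; field; rewrite gt_eqF.
  have h3 : ep * e * dotv u (eta xi) ^+ 2 <= ep * e * (dotv (Sh *m u) (Sh *m u) * dotv w w).
    by rewrite ler_wpM2l // mulr_ge0 ?ltW.
  have h4 : dotv (Sh *m u) (Sh *m u) <= gamma2 D * dotv (Sh *m u) (Sh *m u).
    by rewrite ler_peMl.
  by rewrite SigE subr_ge0 (le_trans h3) // (le_trans h2).
exists F => //; exists (p 1%N); first by rewrite /p /= mulr_gt0 // divr_gt0.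
move=> U mU Uxi; rewrite -[X in (_ <= X)%E](expectation_indic F mU) FE; last exact: measurable_indic.
rewrite lee_fin (bigD1 (inord 1)) //= inordK // /s /= indicE mem_set // mulr1 lerDl.
by apply: sumr_ge0 => i _; rewrite mulr_ge0 // indicE ler0n.
Qed.

(** Each point of the support is an atom of some member of the ambiguity set, so it cannot be
    negligible for all of them. *)
Lemma DM_ae_supp (P : 'cV[R]_k -> Prop) :
  (forall F : probability (borelV R k) R, DM D F -> {ae F, forall xi, P xi}) ->
  forall xi, S xi -> P xi.
Proof.
move=> hP xi /DM_atom[F hF [c c0 hc]]; apply: contrapT => nP.
have [U [mU FU hU]] := hP F hF.
have := hc U mU (hU xi nP); have -> : F U = 0%E := FU.
by rewrite lee_fin leNgt c0.
Qed.

(** Re-expanded around [mu0], the quadratic majorant has linear coefficient [q + 2 Q mu0], whose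
    contribution is bounded by the support function of the ellipsoid, and a quadratic part bounded
    through [gamma2 *: Sigma0]. *)
Lemma weak_duality (F : probability (borelV R k) R) (f : 'cV[R]_k -> R)
    (Q : 'M[R]_k) (q : 'cV[R]_k) (r t : R) :
  DM D F -> continuous f -> psdmx Q ->
  (forall xi, S xi -> f xi <= r + dotv xi (Q *m xi) + dotv q xi) ->
  frob (gamma2 D *: Sigma0 D + mu0 D *m (mu0 D)^T) Q + dotv (mu0 D) q
    + Num.sqrt (gamma1 D) * enorm (Sh *m (q + 2 *: (Q *m mu0 D))) <= t ->
  ('E_F[f] <= (r + t)%:E)%E.
Proof.
move=> [FS Fell [_ Fpsd]] cf hQ hf ht; have [sQ _] := hQ.
rewrite (expectation_mean hS FS cf) lee_fin.
set qt := q + 2 *: (Q *m mu0 D).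
pose c0 := r + dotv (mu0 D) (Q *m mu0 D) + dotv (mu0 D) q.
(* The majorant as a sum over coordinates, to which linearity of [mean] applies. *)
pose g (xi : 'cV[R]_k) := c0 + \sum_i qt i ord0 * (xi i ord0 + - mu0 D i ord0)
  + \sum_j \sum_i Q i j * (eta xi *m (eta xi)^T) i j.
have gE xi : g xi = r + dotv xi (Q *m xi) + dotv q xi.
  have -> : g xi = c0 + dotv qt (eta xi) + frob Q (eta xi *m (eta xi)^T).
    rewrite /g frobE dotvE; congr (_ + _ + _); apply: eq_bigr => i _.
    by rewrite !mxE.
  have -> : dotv qt (eta xi) = dotv q xi - dotv q (mu0 D)
      + 2 * (dotv xi (Q *m mu0 D) - dotv (mu0 D) (Q *m mu0 D)).
    by rewrite /qt dotvBr !dotvDl !dotvZl !(dotvC (Q *m mu0 D)); ring.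
  have -> : frob Q (eta xi *m (eta xi)^T) = dotv xi (Q *m xi)
      - 2 * dotv xi (Q *m mu0 D) + dotv (mu0 D) (Q *m mu0 D).
    rewrite frobC frob_outer mulmxBr dotvBr !dotvBl.
    have -> : dotv (mu0 D) (Q *m xi) = dotv xi (Q *m mu0 D).
      by rewrite dotv_mulmx sQ dotvC.
    ring.
  rewrite /c0 (dotvC (mu0 D) q); ring.
have cc i : continuous (fun xi : 'cV[R]_k => xi i ord0 + - mu0 D i ord0).
  by apply: continuous_add; [exact: coord_continuous|exact: cst_continuous].
have cst a : continuous (fun xi : 'cV[R]_k => a : R) by exact: cst_continuous.
have c1 : continuous (fun xi : 'cV[R]_k => \sum_i qt i ord0 * (xi i ord0 + - mu0 D i ord0)).
  by apply: continuous_sum => i; apply: continuous_mul.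
have c2 j : continuous (fun xi : 'cV[R]_k => \sum_i Q i j * (eta xi *m (eta xi)^T) i j).
  by apply: continuous_sum => i; apply: continuous_mul => //; exact: continuous_outer.
have cg : continuous g.
  apply: continuous_add; last exact: continuous_sum.
  by apply: continuous_add.
have le1 : mean F f <= mean F g.
  by apply: (mean_le hS FS) => // xi Sxi; rewrite gE; exact: hf.
apply: le_trans le1 _.
have -> : mean F g = c0 + dotv qt (meanV F - mu0 D)
    + frob Q (centered_second_moment F (mu0 D)).
  rewrite /g (meanD hS FS); [|by apply: continuous_add|exact: continuous_sum].
  rewrite (meanD hS FS) // mean_cst (mean_sum hS FS); last first.
    by move=> i; apply: continuous_mul.
  rewrite (mean_sum hS FS) // frobE dotvE; congr (_ + _ + _).
    apply: eq_bigr => i _; rewrite (meanZ hS FS) // (meanD hS FS) ?mean_cst //.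
      by rewrite !mxE.
    exact: coord_continuous.
  apply: eq_bigr => j _; rewrite (mean_sum hS FS) //; last first.
    by move=> i; apply: continuous_mul => //; exact: continuous_outer.
  apply: eq_bigr => i _; rewrite (meanZ hS FS) ?mxE //; exact: continuous_outer.
have h1 : dotv qt (meanV F - mu0 D) <= Num.sqrt (gamma1 D) * enorm (Sh *m qt).
  exact: (dotv_ellipsoid_le hSigma hSh).
have := frob_psd_ge0 hQ Fpsd; rewrite frobBr subr_ge0 => h2.
move: ht; rewrite frobDl frob_outer (frobC (_ *: _)) -/qt /c0; lra.
Qed.

End Ambiguity.

(** * Duality for the moment problem *)

Lemma affine_nneg_slope (R : realType) (c d x : R) :
  (forall M, 0 <= M -> c <= d + M * x) -> 0 <= x.
Proof.
move=> h; rewrite leNgt; apply/negP => x0.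
have := h ((`|d - c| + 1) / - x) (divr_ge0 (addr_ge0 (normr_ge0 _) ler01) _).
rewrite oppr_ge0 (ltW x0) => /(_ isT).
rewrite (_ : _ * x = - (`|d - c| + 1)); last by field; rewrite lt_eqF.
have := ler_norm (d - c); lra.
Qed.

(** Lets [e] tend to 0; it serves to reach [alpha] from the levels strictly above it in the
    separated set. *)
Lemma le_of_lt_scaled (R : realType) (c d x : R) :
  0 <= x -> (forall e, 0 < e -> c <= d + e * x) -> c <= d.
Proof.
move=> x0 h; apply/ler_addgt0Pr => e e0.
have x1 : 0 < x + 1 by rewrite ltr_wpDl.
have := h (e / (x + 1)) (divr_gt0 e0 x1).
suff : e / (x + 1) * x <= e by lra.
by rewrite mulrAC ler_pdivrMr // ler_wpM2l ?ltW // ltrDl.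
Qed.

Section ConvexCombinations.
Variables (R : realType) (k : nat) (Sigma Sh : 'M[R]_k) (gamma : R).
Hypotheses (pdS : pdmx Sigma) (sqS : is_sqrtmx Sigma Sh).

Lemma dotv_convex (r : nat) (p : nat -> R) (w : nat -> 'cV[R]_k) :
  (forall i, 0 <= p i) -> \sum_(i < r) p i = 1 ->
  dotv (\sum_(i < r) p i *: w i) (\sum_(i < r) p i *: w i)
    <= \sum_(i < r) p i * dotv (w i) (w i).
Proof.
move=> p0 p1; set m := \sum_(i < r) p i *: w i.
have : 0 <= \sum_(i < r) p i * dotv (w i - m) (w i - m).
  by apply: sumr_ge0 => i _; rewrite mulr_ge0 ?dotv_ge0.
have -> : \sum_(i < r) p i * dotv (w i - m) (w i - m) =
    \sum_(i < r) p i * dotv (w i) (w i)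
    - 2 * \sum_(i < r) p i * dotv (w i) m + (\sum_(i < r) p i) * dotv m m.
  rewrite mulr_suml mulr_sumr -sumrB -big_split; apply: eq_bigr => i _ /=.
  by rewrite dotvBr !dotvBl (dotvC m (w i)); ring.
have -> : \sum_(i < r) p i * dotv (w i) m = dotv m m.
  by rewrite {2}/m dotv_suml; apply: eq_bigr => i _; rewrite dotvZl.
rewrite p1; lra.
Qed.

Lemma ellipsoidE e :
  ellipsoid Sigma gamma e <-> dotv (invmx Sh *m e) (invmx Sh *m e) <= gamma.
Proof.
have uS := sqrtmx_unit pdS sqS.
by rewrite /ellipsoid /= -{1 2}(mulKVmx uS e) (dotv_inv_sqrtmx pdS sqS).
Qed.

Lemma ellipsoid_convex (r : nat) (p : nat -> R) (e : nat -> 'cV[R]_k) :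
  (forall i, 0 <= p i) -> \sum_(i < r) p i = 1 ->
  (forall i, ellipsoid Sigma gamma (e i)) ->
  ellipsoid Sigma gamma (\sum_(i < r) p i *: e i).
Proof.
move=> p0 p1 he; apply/ellipsoidE.
have -> : invmx Sh *m (\sum_(i < r) p i *: e i) = \sum_(i < r) p i *: (invmx Sh *m e i).
  by rewrite mulmx_sumr; apply: eq_bigr => i _; rewrite scalemxAr.
apply: le_trans (dotv_convex (fun i => invmx Sh *m e i) p0 p1) _.
rewrite -[leRHS]mul1r -p1 mulr_suml; apply: ler_sum => i _.
by rewrite ler_wpM2l //; apply/ellipsoidE.
Qed.

End ConvexCombinations.

(** * Strong duality for the moment problem by separation *)

Section MomentProblem.
Variables (R : realType) (d m n k l : nat) (D : data R d m n k l) (Sh : 'M[R]_k).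
Hypotheses (hS : compact (supp D))
  (hemp : empirical_moments (supp D) (mu0 D) (Sigma0 D))
  (hSigma : pdmx (Sigma0 D))
  (hSh : is_sqrtmx (Sigma0 D) Sh)
  (hgamma1 : 0 <= gamma1 D)
  (hgamma2 : 1 <= gamma2 D).
Local Notation S := (supp D).
Local Notation eta xi := (xi - mu0 D).
Variables (N : nat) (phi : 'cV[R]_k -> 'cV[R]_N) (sigma : 'cV[R]_N).
Hypotheses (cphi : contmx phi) (sigma0 : mxle 0 sigma).
Hypothesis ray : forall i, sigma i ord0 = 0 ->
  (forall xi, S xi -> 0 <= phi xi i ord0) /\ exists2 xi, S xi & 0 < phi xi i ord0.

(** In the application [phi] lists the costs of the generators and [sigma] their homogenizing
    components. A single [F] has to serve all indices. *)
Definition moment_level : set R :=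
  [set s | exists2 F, DM D F &
     forall i, ((s * sigma i ord0)%:E <= 'E_F[fun xi => phi xi i ord0])%E].

Variable alpha : R.
Hypothesis alpha_ub : forall s, moment_level s -> s <= alpha.

(* [Z] is not required to be symmetric: its free antisymmetric part forces the
   matrix multiplier of a separating functional to be symmetric. *)
Definition separated_set : set 'cV[R]_(N + (k + k * k)) :=
  [set c | exists xi s tau e Z,
    [/\ S xi, alpha < s, mxle (s *: sigma) tau, ellipsoid (Sigma0 D) (gamma1 D) e
      & (forall u, 0 <= dotv u ((gamma2 D *: Sigma0 D - Z) *m u)) /\
        c = col_mx (tau - phi xi)
              (col_mx (e - eta xi) (mxvec (Z - eta xi *m (eta xi)^T))^T)]].

Lemma separated_set_ne0 : separated_set !=set0.
Proof.
eexists; exists (mu0 D), (alpha + 1), ((alpha + 1) *: sigma), 0, (gamma2 D *: Sigma0 D).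
split; last by split=> [u|]; [rewrite subrr mul0mx dotv0r|reflexivity].
- exact: supp_mu0.
- by rewrite ltrDl.
- by [].
- by rewrite /ellipsoid /= dotv0l.
Qed.

(** A vanishing combination would make the discrete probability with weights [p] and atoms [xi i] a
    member of the ambiguity set, reaching the average of the levels [s i], which is strictly above
    [alpha]. *)
Lemma separated_set_conv (r : nat) (c : nat -> 'cV[R]_(N + (k + k * k))) (p : nat -> R) :
  (forall i, (i < r)%N -> separated_set (c i)) -> (forall i, 0 <= p i) ->
  \sum_(i < r) p i = 1 -> \sum_(i < r) p i *: c i != 0.
Proof.
move=> hc p0 p1; apply/eqP => csum.
have [c0 hc0] := separated_set_ne0.
(* Indices from [r] on are filled with [c0], so that witnesses can be chosen for every natural
   number. *)
pose c' i := if (i < r)%N then c i else c0.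
have hc' i : separated_set (c' i) by rewrite /c'; case: ifP => // /hc.
have {}csum : \sum_(i < r) p i *: c' i = 0.
  by rewrite -[RHS]csum; apply: eq_bigr => i _; rewrite /c' ltn_ord.
have /choice[xi /choice[s /choice[tau /choice[e /choice[Z hZ]]]]] := hc'.
have [Sxi hs htau he hZZ] : [/\ forall i, S (xi i), forall i, alpha < s i,
    forall i, mxle (s i *: sigma) (tau i),
    forall i, ellipsoid (Sigma0 D) (gamma1 D) (e i)
    & forall i, (forall u, 0 <= dotv u ((gamma2 D *: Sigma0 D - Z i) *m u)) /\
        c' i = col_mx (tau i - phi (xi i))
              (col_mx (e i - eta (xi i)) (mxvec (Z i - eta (xi i) *m (eta (xi i))^T))^T)].
  by split=> i; have [] := hZ i.
have sumE : \sum_(i < r) p i *: c' i =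
    col_mx (\sum_(i < r) p i *: (tau i - phi (xi i)))
      (col_mx (\sum_(i < r) p i *: (e i - eta (xi i)))
         (mxvec (\sum_(i < r) p i *: (Z i - eta (xi i) *m (eta (xi i))^T)))^T).
  have vD (U V : 'M[R]_k) (t : R) :
      (mxvec U)^T + t *: (mxvec V)^T = (mxvec (U + t *: V))^T.
    by apply/matrixP => i j; rewrite linearD linearZ !mxE.
  elim: (r) => [|r' IH]; first by rewrite !big_ord0 linear0 trmx0 !col_mx0.
  rewrite !big_ord_recr /= IH (hZZ r').2 !scale_col_mx !add_col_mx.
  by rewrite vD.
move: csum; rewrite sumE -[0 in RHS]col_mx0 => /eq_col_mx[tau_eq].
rewrite -[0 in RHS]col_mx0 => /eq_col_mx[e_eq Z_eq].
have {}Z_eq : \sum_(i < r) p i *: (Z i - eta (xi i) *m (eta (xi i))^T) = 0.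
  by apply: (can_inj mxvecK); apply: trmx_inj; rewrite Z_eq linear0 trmx0.
have {}tau_eq : \sum_(i < r) p i *: phi (xi i) = \sum_(i < r) p i *: tau i.
  apply/esym/eqP; rewrite -subr_eq0 -sumrB; apply/eqP; rewrite -[RHS]tau_eq.
  by apply: eq_bigr => i _; rewrite scalerBr.
have {}e_eq : \sum_(i < r) p i *: eta (xi i) = \sum_(i < r) p i *: e i.
  apply/esym/eqP; rewrite -subr_eq0 -sumrB; apply/eqP; rewrite -[RHS]e_eq.
  by apply: eq_bigr => i _; rewrite [RHS]scalerBr.
have {}Z_eq : \sum_(i < r) p i *: (eta (xi i) *m (eta (xi i))^T) = \sum_(i < r) p i *: Z i.
  apply/esym/eqP; rewrite -subr_eq0 -sumrB; apply/eqP; rewrite -[RHS]Z_eq.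
  by apply: eq_bigr => i _; rewrite [RHS]scalerBr.
have [||F hF FE] := @discrete_DM R d m n k l D hS hSigma r p xi p0 p1 Sxi.
- by rewrite e_eq; apply: (ellipsoid_convex hSigma hSh).
- move=> u; rewrite Z_eq -[gamma2 D *: _]scale1r -p1 scaler_suml -sumrB mulmx_suml.
  rewrite dotv_sumr; apply: sumr_ge0 => i _.
  by rewrite -scalerBr -scalemxAl dotvZr mulr_ge0 //; exact: (hZZ i).1.
suff : \sum_(i < r) p i * s i <= alpha.
  have : alpha < \sum_(i < r) p i * s i.
    have : 0 <= \sum_(i < r) p i * (s i - alpha).
      by apply: sumr_ge0 => i _; rewrite mulr_ge0 // subr_ge0 ltW.
    have aE : \sum_(i < r) p i * (s i - alpha) = \sum_(i < r) p i * s i - alpha.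
      rewrite -[X in _ = _ - X]mul1r -p1 mulr_suml -sumrB.
      by apply: eq_bigr => i _; rewrite mulrBr.
    rewrite -subr_gt0 -aE le_eqVlt => /predU1P[/esym/eqP|//].
    rewrite psumr_eq0 => [/allP h|i _]; last by rewrite mulr_ge0 // subr_ge0 ltW.
    suff : \sum_(i < r) p i = 0 by rewrite p1 => /eqP; rewrite oner_eq0.
    apply: big1 => i _; have := h i (mem_index_enum _); rewrite /= mulf_eq0 subr_eq0.
    by rewrite (gt_eqF (hs i)) orbF => /eqP.
  by move=> h1 /(lt_le_trans h1); rewrite ltxx.
apply: alpha_ub; exists F => // i; rewrite FE; last first.
  by apply: measurable_continuous; exact: cphi.
rewrite lee_fin (_ : \sum_(j < r) p j * phi (xi j) i ord0 =
    (\sum_(j < r) p j *: phi (xi j)) i ord0).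
  rewrite tau_eq summxE mulr_suml; apply: ler_sum => j _.
  rewrite mxE -mulrA ler_wpM2l //.
  by have := htau j i ord0; rewrite mxE.
by rewrite summxE; apply: eq_bigr => j _; rewrite mxE.
Qed.

Lemma separating_functional : exists (a : 'cV[R]_N) (b : 'cV[R]_k) (G : 'M[R]_k),
  [\/ a != 0, b != 0 | G != 0] /\
  forall xi s tau e Z, S xi -> alpha < s -> mxle (s *: sigma) tau ->
    ellipsoid (Sigma0 D) (gamma1 D) e ->
    (forall u, 0 <= dotv u ((gamma2 D *: Sigma0 D - Z) *m u)) ->
    dotv a (phi xi) + dotv b (eta xi) + dotv (eta xi) (G *m eta xi)
      <= dotv a tau + dotv b e + frob G Z.
Proof.
have [y y0 hy] := separation separated_set_ne0 separated_set_conv.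
pose a := usubmx y; pose b := usubmx (dsubmx y).
pose G := vec_mx (dsubmx (dsubmx y))^T.
have yE : y = col_mx a (col_mx b (mxvec G)^T).
  by rewrite /G vec_mxK trmxK !vsubmxK.
exists a, b, G; split.
  have [a0|] := eqVneq a 0; last by constructor 1.
  have [b0|] := eqVneq b 0; last by constructor 2.
  constructor 3; apply: contra y0 => /eqP G0.
  by rewrite yE a0 b0 G0 linear0 trmx0 !col_mx0.
move=> xi s tau e Z Sxi hs htau he hZ.
have := hy (col_mx (tau - phi xi)
  (col_mx (e - eta xi) (mxvec (Z - eta xi *m (eta xi)^T))^T)).
rewrite yE !dotv_col_mx frob_mxvec frobBr (frobC G (_ *m _)) frob_outer !dotvBr.
have h : separated_set (col_mx (tau - phi xi)
  (col_mx (e - eta xi) (mxvec (Z - eta xi *m (eta xi)^T))^T)).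
  by exists xi, s, tau, e, Z.
move=> /(_ h); lra.
Qed.

(** Recession directions of the separated set give the signs: raising [tau] yields [a >= 0],
    lowering [Z] by multiples of [v *m v^T] makes [G] negative semidefinite, and [Q] is [- G]. The
    bound is the limit of [s] to [alpha], with [Z] equal to [gamma2 *: Sigma0] and [e] minimizing
    [dotv b e]. *)
Lemma separating_psd : exists (a : 'cV[R]_N) (b : 'cV[R]_k) (Q : 'M[R]_k),
  [/\ [\/ a != 0, b != 0 | Q != 0], mxle 0 a, psdmx Q &
  forall xi, S xi ->
    dotv a (phi xi) + dotv b (eta xi) - dotv (eta xi) (Q *m eta xi)
      <= alpha * dotv a sigma - Num.sqrt (gamma1 D) * enorm (Sh *m b)
         - gamma2 D * frob Q (Sigma0 D)].
Proof.
have [a [b [G [nz hG]]]] := separating_functional.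
pose C := dotv a (phi (mu0 D)).
pose Z0 := gamma2 D *: Sigma0 D.
have e0 : ellipsoid (Sigma0 D) (gamma1 D) 0 by rewrite /ellipsoid /= dotv0l.
have hG0 tau Z : mxle ((alpha + 1) *: sigma) tau ->
    (forall u, 0 <= dotv u ((Z0 - Z) *m u)) -> C <= dotv a tau + frob G Z.
  move=> htau hZ; have al : alpha < alpha + 1 by rewrite ltrDl.
  have := hG _ _ tau 0 Z (supp_mu0 hemp) al htau e0 hZ.
  by rewrite subrr mulmx0 !dotv0r !addr0.
have Z00 u : 0 <= dotv u ((Z0 - Z0) *m u) by rewrite subrr mul0mx dotv0r.
have a0 : mxle 0 a.
  move=> i j; rewrite ord1 mxE.
  apply: (@affine_nneg_slope _ C (dotv a ((alpha + 1) *: sigma) + frob G Z0)) => M M0.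
  rewrite addrAC -dotv_delta (dotvC _ a) -dotvZr -dotvDr; apply: hG0 => // i' j'.
  by rewrite [X in _ <= X]mxE lerDl !mxE mulr_ge0.
have Gneg v : dotv v (G *m v) <= 0.
  rewrite -oppr_ge0.
  apply: (@affine_nneg_slope _ C (dotv a ((alpha + 1) *: sigma) + frob G Z0)) => M M0.
  rewrite -frob_outer (frobC _ G) mulrN -frobZr -addrA -frobBr; apply: hG0 => // u.
  rewrite opprB addrCA subrr addr0 -scalemxAl dotvZr mulr_ge0 //.
  by rewrite -mulmxA [_^T *m u]mx11_scalar -/(dotv _ _) mul_mx_scalar dotvZr dotvC -expr2 sqr_ge0.
have Gsym : symmx G.
  (* [K] is antisymmetric, so [Z0 + c *: K] is admissible for both signs of [c]. This forces
     [frob G K = 0], and [frob K K] is twice that number. *)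
  pose K := G - G^T.
  have KT : K^T = - K by rewrite /K linearB /= trmxK opprB.
  have Kform (c : R) u : dotv u ((c *: K) *m u) = 0.
    have : dotv u (K *m u) = - dotv u (K *m u).
      by rewrite -[RHS]dotvNr -mulNmx -KT [RHS]dotvC -[in RHS](trmxK K) -dotv_mulmx trmxK.
    rewrite -scalemxAl dotvZr => h; have -> : dotv u (K *m u) = 0 by lra.
    by rewrite mulr0.
  have Kc (c : R) : C <= dotv a ((alpha + 1) *: sigma) + frob G Z0 + c * frob G K.
    rewrite -addrA -frobZr -frobDr; apply: hG0 => // u.
    by rewrite opprD addNKr -scaleNr Kform.
  have GK : frob G K = 0.
    apply/eqP; rewrite eq_le; apply/andP; split.
      by rewrite -oppr_ge0; apply: affine_nneg_slope => M _; rewrite mulrN -mulNr; exact: Kc.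
    by apply: affine_nneg_slope => M _; exact: Kc.
  have : frob K K = 0.
    have GTK : frob G^T K = frob G K^T.
      rewrite !frobE exchange_big /=; apply: eq_bigr => i _.
      by apply: eq_bigr => j _; rewrite mxE [in RHS]mxE.
    by rewrite {1}/K frobDl frobNl GTK KT frobNr GK oppr0 subrr.
  rewrite -frob_mxvec => /dotv_eq0 /(congr1 trmx); rewrite trmxK trmx0 => K0.
  have : K = 0 by rewrite -[K]mxvecK K0 linear0.
  by move=> /eqP; rewrite subr_eq0 => /eqP h; exact: esym h.
exists a, b, (- G); split.
- by case: nz => h; [constructor 1|constructor 2|constructor 3; rewrite oppr_eq0].
- exact: a0.
- split; first by rewrite /symmx linearN /= Gsym.
  by move=> u; rewrite mulNmx dotvNr oppr_ge0.
move=> xi Sxi; rewrite mulNmx dotvNr opprK frobNl mulrN opprK.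
have [e he be] := dotv_ellipsoid_attained hSigma hSh hgamma1 b.
apply: (@le_of_lt_scaled _ _ _ (dotv a sigma)); first exact: dotv_nneg.
move=> ep ep0; have al : alpha < alpha + ep by rewrite ltrDl.
have := hG xi _ ((alpha + ep) *: sigma) e Z0 Sxi al (fun _ _ => lexx _) he Z00.
rewrite dotvZr frobZr be; lra.
Qed.

(** Division of the separating inequality by [dotv a sigma] normalizes the weights, and expanding
    [eta] back into [xi] gives the quadratic majorant. The main point is that [dotv a sigma] is
    nonzero. *)
Lemma moment_dual : exists (a : 'cV[R]_N) (Q : 'M[R]_k) (q : 'cV[R]_k) (r t : R),
  [/\ mxle 0 a /\ dotv a sigma = 1, psdmx Q,
      frob (gamma2 D *: Sigma0 D + mu0 D *m (mu0 D)^T) Q + dotv (mu0 D) q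
        + Num.sqrt (gamma1 D) * enorm (Sh *m (q + 2 *: (Q *m mu0 D))) <= t,
      r + t = alpha
    & forall xi, S xi -> dotv a (phi xi) <= r + dotv xi (Q *m xi) + dotv q xi].
Proof.
have [a [b [Q [nz a0 hQ main]]]] := separating_psd.
have sgi i : 0 <= sigma i ord0 by have := sigma0 i ord0; rewrite mxE.
have ai i : 0 <= a i ord0 by have := a0 i ord0; rewrite mxE.
have kap0 : 0 <= dotv a sigma by exact: dotv_nneg.
have ell0 u : 0 <= Num.sqrt (gamma1 D) * enorm (Sh *m u).
  by rewrite mulr_ge0 ?sqrtr_ge0.
have QS0 : 0 <= frob Q (Sigma0 D).
  by apply: frob_psd_ge0 => //; have [] := pd_psd hSigma.
have gQS0 : frob Q (Sigma0 D) <= gamma2 D * frob Q (Sigma0 D) by rewrite ler_peMl.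
have Smu := supp_mu0 hemp.
have kap_neq0 : dotv a sigma != 0.
  apply/eqP => kap_eq0.
  (* Only indices with [sigma i = 0] can carry weight, and [ray] then makes [dotv a (phi xi)]
     nonnegative on the support. *)
  have aray i : a i ord0 = 0 \/ sigma i ord0 = 0.
    have : dotv a sigma == 0 by rewrite kap_eq0.
    rewrite dotvE psumr_eq0 => [/allP h|j _]; last exact: mulr_ge0.
    have := h i (mem_index_enum _); rewrite /= mulf_eq0 => /orP[] /eqP; by [left|right].
  have aphi xi i : S xi -> 0 <= a i ord0 * phi xi i ord0.
    move=> Sxi; have [->|/ray[h _]] := aray i; first by rewrite mul0r.
    by rewrite mulr_ge0 // h.
  have dphi xi : S xi -> 0 <= dotv a (phi xi).
    by move=> Sxi; rewrite dotvE sumr_ge0 // => i _; exact: aphi.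
  (* At [mu0] the terms in [eta] vanish, which leaves [frob Q (Sigma0 D) <= 0]. *)
  have Q0 : Q = 0.
    have := main _ Smu; rewrite kap_eq0 mulr0 subrr mulmx0 !dotv0r addr0 subr0 => h.
    apply: (frob_pd_eq0 hQ hSigma); have := dphi _ Smu; have := ell0 b; lra.
  have main' xi : S xi -> dotv a (phi xi) + dotv b (eta xi) <= 0.
    move=> /main; rewrite kap_eq0 Q0 mul0mx dotv0r frobC frob0r; have := ell0 b; lra.
  have b0 : b = 0.
    (* A small step from [mu0] along [b] stays in the support and would make the left side positive
       unless [b = 0]. *)
    have [e e0 Se] := supp_mu0_interior hemp hSigma b.
    have eE : eta (mu0 D + e *: b) = e *: b by rewrite addrC addKr.
    have := main' _ Se; rewrite eE dotvZr => h.
    have h' := dphi _ Se; have bb := dotv_ge0 b.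
    have h2 : 0 <= e * dotv b b by rewrite mulr_ge0 // ltW.
    have : e * dotv b b = 0 by lra.
    by move=> /eqP; rewrite mulf_eq0 gt_eqF //= => /eqP /dotv_eq0.
  have aE : a = 0.
    apply/colP => i; rewrite mxE; have [//|si] := aray i.
    have [_ [xi Sxi ph]] := ray si.
    have := main' _ Sxi; rewrite b0 dotv0l addr0 dotvE (bigD1 i) //= => h.
    have h2 : 0 <= \sum_(j | j != i) a j ord0 * phi xi j ord0.
      by apply: sumr_ge0 => j _; exact: aphi.
    have h3 := aphi _ i Sxi.
    have : a i ord0 * phi xi i ord0 = 0 by lra.
    by move=> /eqP; rewrite mulf_eq0 (gt_eqF ph) orbF => /eqP.
  by case: nz; rewrite ?aE ?b0 ?Q0 eqxx.
set kap := dotv a sigma in kap0 kap_neq0 main.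
have kap_gt0 : 0 < kap by rewrite lt_def kap_neq0.
have ki0 : 0 <= kap^-1 by rewrite invr_ge0.
pose Q' := kap^-1 *: Q.
have hQ' : psdmx Q'.
  have [sQ pQ] := hQ; split; first by rewrite /symmx /Q' linearZ /= sQ.
  by move=> u; rewrite -scalemxAl dotvZr mulr_ge0.
(* Chosen so that [q' + 2 *: (Q' *m mu0 D)], which enters the norm in [t], is [- (kap^-1 *: b)]. *)
pose q' := - (kap^-1 *: b) - 2 *: (Q' *m mu0 D).
pose t := frob (gamma2 D *: Sigma0 D + mu0 D *m (mu0 D)^T) Q' + dotv (mu0 D) q'
        + Num.sqrt (gamma1 D) * enorm (Sh *m (q' + 2 *: (Q' *m mu0 D))).
exists (kap^-1 *: a), Q', q', (alpha - t), t; split.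
- split; last by rewrite dotvZl mulVf.
  by move=> i j; rewrite ord1 !mxE mulr_ge0.
- exact: hQ'.
- exact: lexx.
- by rewrite subrK.
move=> xi Sxi; have := ler_wpM2l ki0 (main _ Sxi).
have tE : t = gamma2 D * (kap^-1 * frob Q (Sigma0 D)) + dotv (mu0 D) (Q' *m mu0 D)
    + dotv (mu0 D) q' + kap^-1 * (Num.sqrt (gamma1 D) * enorm (Sh *m b)).
  rewrite /t frobDl frob_outer frobZl frobC frobZl subrK; congr (_ + _).
  rewrite mulmxN -scalemxAr /enorm dotvNl dotvNr opprK dotvZl dotvZr mulrA.
  rewrite sqrtrM -?expr2 ?sqr_ge0 // sqrtr_sqr ger0_norm //; ring.
have [sQ' _] := hQ'.
have etaE : dotv (eta xi) (Q' *m eta xi) = dotv xi (Q' *m xi)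
    - 2 * dotv xi (Q' *m mu0 D) + dotv (mu0 D) (Q' *m mu0 D).
  rewrite mulmxBr dotvBr !dotvBl.
  have -> : dotv (mu0 D) (Q' *m xi) = dotv xi (Q' *m mu0 D).
    by rewrite dotv_mulmx sQ' dotvC.
  ring.
have etaE' : dotv (eta xi) (Q' *m eta xi) = kap^-1 * dotv (eta xi) (Q *m eta xi).
  by rewrite -scalemxAl dotvZr.
have qE : dotv q' xi = - (kap^-1 * dotv b xi) - 2 * dotv xi (Q' *m mu0 D).
  by rewrite /q' dotvBl dotvNl !dotvZl (dotvC (Q' *m mu0 D)).
have qE' : dotv (mu0 D) q' = - (kap^-1 * dotv b (mu0 D)) - 2 * dotv (mu0 D) (Q' *m mu0 D).
  by rewrite /q' dotvBr dotvNr !dotvZr (dotvC b).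
rewrite dotvZl dotvBr tE qE qE'.
have -> : kap^-1 * (alpha * kap - Num.sqrt (gamma1 D) * enorm (Sh *m b)
    - gamma2 D * frob Q (Sigma0 D)) = alpha - kap^-1 * (Num.sqrt (gamma1 D) * enorm (Sh *m b))
    - gamma2 D * (kap^-1 * frob Q (Sigma0 D)) by field.
have -> : kap^-1 * (dotv a (phi xi) + (dotv b xi - dotv b (mu0 D))
    - dotv (eta xi) (Q *m eta xi)) = kap^-1 * dotv a (phi xi) + kap^-1 * dotv b xi
    - kap^-1 * dotv b (mu0 D) - (kap^-1 * dotv (eta xi) (Q *m eta xi)) by ring.
rewrite -etaE' etaE; lra.
Qed.

End MomentProblem.

(** * Linear decision rules *)

Section PolyhedralSets.
Variables (R : realFieldType) (E : vectType R).

(** Linearity as a plain predicate, proved by composition; bundling into a linear form is left to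
    [lin_formP]. *)
Definition lin_map (V : lmodType R) (f : E -> V) : Prop :=
  forall a u v, f (a *: u + v) = a *: f u + f v.

Definition lin_form (f : E -> R) : Prop :=
  forall a u v, f (a *: u + v) = a * f u + f v.

Lemma lin_formP (f : E -> R) : lin_form f -> exists g : {scalar E}, g =1 f.
Proof.
move=> hf; have hf' : linear_for *%R f by [].
pose f_mixin := GRing.isLinear.Build R E R *%R f hf'.
pose g : {scalar E} := HB.pack f f_mixin.
by exists g.
Qed.

Lemma lin_mapD (V : lmodType R) (f g : E -> V) :
  lin_map f -> lin_map g -> lin_map (fun u => f u + g u).
Proof. by move=> hf hg a u v; rewrite hf hg scalerDr addrACA. Qed.

Lemma lin_mapN (V : lmodType R) (f : E -> V) : lin_map f -> lin_map (fun u => - f u).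
Proof. by move=> hf a u v; rewrite hf opprD scalerN. Qed.

Lemma lin_mapMl p q r (C : 'M[R]_(p, q)) (f : E -> 'M[R]_(q, r)) :
  lin_map f -> lin_map (fun u => C *m f u).
Proof. by move=> hf a u v; rewrite hf mulmxDr scalemxAr. Qed.

Lemma lin_mapMr p q r (C : 'M[R]_(q, r)) (f : E -> 'M[R]_(p, q)) :
  lin_map f -> lin_map (fun u => f u *m C).
Proof. by move=> hf a u v; rewrite hf mulmxDl scalemxAl. Qed.

Lemma lin_mapZ (V : lmodType R) (C : V) (f : E -> R) :
  lin_form f -> lin_map (fun u => f u *: C).
Proof. by move=> hf a u v; rewrite hf scalerDl scalerA. Qed.

Lemma lin_form_comb (f : E -> R) (I : Type) (r : seq I) (a : I -> R) (v : I -> E) :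
  lin_form f -> f (\sum_(i <- r) a i *: v i) = \sum_(i <- r) a i * f (v i).
Proof.
by move=> /lin_formP[g gf]; rewrite -gf linear_comb; apply: eq_bigr => i _; rewrite gf.
Qed.

Definition polyhedral (C : E -> Prop) : Prop :=
  exists s (l : nat -> {scalar E}), forall x, C x <-> forall i, (i < s)%N -> 0 <= l i x.

Lemma polyhedralI (C C' : E -> Prop) :
  polyhedral C -> polyhedral C' -> polyhedral (fun x => C x /\ C' x).
Proof.
move=> [s [l hl]] [s' [l' hl']].
exists (s + s')%N, (fun i => if (i < s)%N then l i else l' (i - s)%N) => x.
split=> [[/hl h /hl' h'] i lti|h].
  case: ifP => [/h//|/negbT]; rewrite -leqNgt => lei; apply: h'.
  by rewrite ltn_subLR.
split; [apply/hl => i lti|apply/hl' => i lti].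
  by have := h i; rewrite lti; apply; rewrite ltn_addr.
have nlt : (s + i < s)%N = false by rewrite ltnNge leq_addr.
by have := h (s + i)%N; rewrite nlt addKn ltn_add2l; apply.
Qed.

Lemma polyhedral_form (f : E -> R) : lin_form f -> polyhedral (fun x => 0 <= f x).
Proof.
move=> /lin_formP[g gf]; exists 1%N, (fun=> g) => x.
by split=> [h [|i]//|/(_ 0%N isT)]; rewrite gf.
Qed.

Lemma polyhedral_forall (I : finType) (C : I -> E -> Prop) :
  (forall i, polyhedral (C i)) -> polyhedral (fun x => forall i, C i x).
Proof.
move=> hC; suff [s [l hl]] : polyhedral (fun x => forall i, i \in enum I -> C i x).
  exists s, l => x; split=> [h|/hl h i]; last by apply: h; rewrite mem_enum.
  by apply/hl => i _.
elim: (enum I) => [|i r [s [l hl]]].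
  have [|g _] := @lin_formP (fun=> 0); first by move=> a u v; rewrite mulr0 addr0.
  by exists 0%N, (fun=> g) => x.
have [s' [l' hl']] := polyhedralI (hC i) (ex_intro _ s (ex_intro _ l hl)).
exists s', l' => x; split=> [h|/hl'[h1 h2] j].
  apply/hl'; split=> [|j jr]; apply: h; first exact: mem_head.
  by rewrite inE jr orbT.
by rewrite inE => /predU1P[->//|]; apply: h2.
Qed.

Lemma polyhedral_mx_ge0 p q (f : E -> 'M[R]_(p, q)) :
  lin_map f -> polyhedral (fun x => forall i j, 0 <= f x i j).
Proof.
move=> hf; apply: polyhedral_forall => i; apply: polyhedral_forall => j.
by apply: polyhedral_form => a u v; rewrite hf !mxE.
Qed.

Lemma polyhedral_mx_eq0 p q (f : E -> 'M[R]_(p, q)) :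
  lin_map f -> polyhedral (fun x => f x = 0).
Proof.
move=> hf; have [s [l hl]] := polyhedralI (polyhedral_mx_ge0 hf)
  (polyhedral_mx_ge0 (lin_mapN hf)).
exists s, l => x; rewrite -hl; split=> [->|[h1 h2]].
  by split=> i j; rewrite !mxE ?oppr0.
apply/matrixP => i j; rewrite mxE; apply/eqP; rewrite eq_le h1 andbT.
by have := h2 i j; rewrite mxE oppr_ge0.
Qed.

End PolyhedralSets.

(** * The homogenized cone of linear decision rules *)

Section HomogenizedLDR.
Variables (R : realType) (d m n k l : nat) (D : data R d m n k l).
Variable x : {ffun 'I_d -> bool}.

(* Tuples (T, Lambda, p0, Y, y0, lambda, s), with s the homogenizing variable. *)
Definition hvar := ('M[R]_(m, l) * 'M[R]_(m, l) * 'cV[R]_m * 'M[R]_(n, k)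
  * 'cV[R]_n * R^o * R^o)%type.
Implicit Types u : hvar.

Definition hT u : 'M[R]_(m, l) := u.1.1.1.1.1.1.
Definition hLambda u : 'M[R]_(m, l) := u.1.1.1.1.1.2.
Definition hp0 u : 'cV[R]_m := u.1.1.1.1.2.
Definition hY u : 'M[R]_(n, k) := u.1.1.1.2.
Definition hy0 u : 'cV[R]_n := u.1.1.2.
Definition hlambda u : R := u.1.2.
Definition hs u : R := u.2.

Lemma lin_hT : lin_map hT. Proof. by []. Qed.
Lemma lin_hLambda : lin_map hLambda. Proof. by []. Qed.
Lemma lin_hp0 : lin_map hp0. Proof. by []. Qed.
Lemma lin_hY : lin_map hY. Proof. by []. Qed.
Lemma lin_hy0 : lin_map hy0. Proof. by []. Qed.
Lemma lin_hlambda : lin_form hlambda. Proof. by []. Qed.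
Lemma lin_hs : lin_form hs. Proof. by []. Qed.

(** The constraints of (LDR) for the given [x], with [P = T W] and with [T], [Lambda] the affine
    Farkas multipliers of the two inequalities over the support. Multiplying [V] and [v_0] by [s]
    makes every condition homogeneous. *)
Definition hcone u : Prop :=
  [/\ (A D)^T *m (hT u *m W D) + hlambda u *: cC D - hs u *: vV D = 0
        /\ (A D)^T *m hp0 u + hlambda u *: cc0 D - hs u *: vv0 D = 0,
      (forall i j, 0 <= (hT u *m h D + hp0 u) i j) /\ (forall i j, 0 <= hT u i j),
      A D *m hY u + hLambda u *m W D - hlambda u *: Bx D x = 0,
      (forall i j, 0 <= (hLambda u *m h D - A D *m hy0 u + hlambda u *: bx0 D x) i j)
        /\ (forall i j, 0 <= hLambda u i j)
    & 0 <= hlambda u /\ 0 <= hs u].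

Lemma hcone_polyhedral : polyhedral hcone.
Proof.
have lT := lin_hT; have lL := lin_hLambda; have lp := lin_hp0.
have lY := lin_hY; have ly := lin_hy0; have ll := lin_hlambda; have ls := lin_hs.
have := polyhedralI
  (polyhedralI
    (polyhedral_mx_eq0 (lin_mapD (lin_mapD (lin_mapMl (A D)^T (lin_mapMr (W D) lT))
       (lin_mapZ (cC D) ll)) (lin_mapN (lin_mapZ (vV D) ls))))
    (polyhedral_mx_eq0 (lin_mapD (lin_mapD (lin_mapMl (A D)^T lp)
       (lin_mapZ (cc0 D) ll)) (lin_mapN (lin_mapZ (vv0 D) ls)))))
  (polyhedralI
    (polyhedralI (polyhedral_mx_ge0 (lin_mapD (lin_mapMr (h D) lT) lp))
       (polyhedral_mx_ge0 lT))
    (polyhedralI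
      (polyhedral_mx_eq0 (lin_mapD (lin_mapD (lin_mapMl (A D) lY)
         (lin_mapMr (W D) lL)) (lin_mapN (lin_mapZ (Bx D x) ll))))
      (polyhedralI
        (polyhedralI
          (polyhedral_mx_ge0 (lin_mapD (lin_mapD (lin_mapMr (h D) lL)
             (lin_mapN (lin_mapMl (A D) ly))) (lin_mapZ (bx0 D x) ll)))
          (polyhedral_mx_ge0 lL))
        (polyhedralI (polyhedral_form ll) (polyhedral_form ls))))).
move=> [s [f hf]]; exists s, f => u; rewrite -hf /hcone.
by split=> [[? ? ? ? ?]|[? [? [? [? ?]]]]].
Qed.

Definition hobj u (xi : 'cV[R]_k) : R :=
  dotv (bx_of D x xi) (hT u *m W D *m xi + hp0 u) + dotv (c_of D xi) (hY u *m xi + hy0 u).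

Lemma lin_hobj xi : lin_form (hobj^~ xi).
Proof.
move=> a u v; rewrite /hobj lin_hT lin_hp0 lin_hY lin_hy0 !mulmxDl !dotvDr.
by rewrite -!scalemxAl !dotvZr; ring.
Qed.

Lemma continuous_hobj u : continuous (hobj u).
Proof.
by apply: continuous_add; apply: continuous_dotv; apply: contmx_affine.
Qed.

Hypotheses (hS : compact (supp D))
  (hemp : empirical_moments (supp D) (mu0 D) (Sigma0 D))
  (hSigma : pdmx (Sigma0 D)).
Local Notation S := (supp D).

Lemma mxle_supp p (T : 'M[R]_(p, l)) (g : 'cV[R]_p) xi :
  (forall i j, 0 <= T i j) -> (forall i j, 0 <= (T *m h D + g) i j) -> S xi ->
  mxle 0 (T *m W D *m xi + g).
Proof.
move=> T0 hT0 Sxi i j; rewrite [X in X <= _]mxE; apply: le_trans (hT0 i j) _.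
rewrite -mulmxA !mxE lerD2r; apply: ler_sum => a _.
by rewrite ler_wpM2l //; exact: Sxi.
Qed.

Lemma hcone_p u xi : hcone u -> S xi ->
  (A D)^T *m (hT u *m W D *m xi + hp0 u) + hlambda u *: c_of D xi = hs u *: v_of D xi /\
  mxle 0 (hT u *m W D *m xi + hp0 u).
Proof.
move=> [[e1 e2] [e3 e4] _ _ _] Sxi; split; last exact: mxle_supp.
move/eqP: e1; rewrite subr_eq0 => /eqP e1; move/eqP: e2; rewrite subr_eq0 => /eqP e2.
rewrite /c_of /v_of !scalerDr mulmxDr addrACA e2 !scalemxAl -e1 mulmxDl.
by rewrite !mulmxA.
Qed.

Lemma hcone_y u xi : hcone u -> S xi ->
  mxle (A D *m (hY u *m xi + hy0 u)) (hlambda u *: bx_of D x xi).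
Proof.
move=> [_ _ e1 [e2 e3] _] Sxi i j; move/eqP: e1; rewrite subr_eq0 => /eqP e1.
have := @mxle_supp _ (hLambda u) (- (A D *m hy0 u) + hlambda u *: bx0 D x) xi e3.
rewrite addrA => /(_ e2 Sxi i j); rewrite mxE => h0.
rewrite -subr_ge0; apply: le_trans h0 _; rewrite le_eqVlt; apply/orP; left; apply/eqP.
have -> : hlambda u *: bx_of D x xi = A D *m hY u *m xi + hLambda u *m W D *m xi
    + hlambda u *: bx0 D x.
  by rewrite /bx_of scalerDr scalemxAl -e1 mulmxDl.
rewrite mulmxDr mulmxA !mxE; ring.
Qed.

Hypothesis hYx : forall xi, S xi ->
  let Yset := [set y : 'cV[R]_n | mxle (A D *m y) (bx_of D x xi)] in
  Yset !=set0 /\ bounded_set Yset.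

(** Such a [y] is a recession direction of the recourse set at [mu0], which is nonempty and
    bounded. *)
Lemma mulA_le0 (y : 'cV[R]_n) : mxle (A D *m y) 0 -> y = 0.
Proof.
move=> hy; have [[z hz] [K [_ hK]]] := hYx (supp_mu0 hemp).
apply/eqP; rewrite -normr_eq0; apply/negPn/negP => y0.
have ygt0 : 0 < `|y| by rewrite lt_def y0 /=.
pose t := (`|K| + `|z| + 2) / `|y|.
have t0 : 0 <= t by rewrite divr_ge0 // !addr_ge0.
have Yt : mxle (A D *m (z + t *: y)) (bx_of D x (mu0 D)).
  move=> i j; rewrite mulmxDr -scalemxAr mxE -[leRHS]addr0; apply: lerD; first exact: hz.
  by rewrite mxE; have := hy i j; rewrite [X in _ <= X]mxE => h; rewrite mulr_ge0_le0.
have K1 : K < `|K| + 1 by rewrite ltr_pwDr // ler_norm.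
have := hK _ K1 _ Yt; apply/negP; rewrite -ltNge.
have : `|t *: y| <= `|z + t *: y| + `|z|.
  by rewrite -[X in `|X| <= _](addKr z) addrC; apply: le_trans (ler_normD _ _) _; rewrite normrN.
rewrite normrZ ger0_norm // /t divfK //; lra.
Qed.

(* Along a recession direction, lambda * obj = lambda b'p + lambda c'y
   >= (A y)'p + lambda c'y = y'(A'p + lambda c) = 0; if lambda = 0 then y = 0 and
   b'p >= y'A'p = 0 for any y in the recourse polytope. *)
Lemma hobj_recession u xi : hcone u -> hs u = 0 -> S xi -> 0 <= hobj u xi.
Proof.
move=> hu s0 Sxi; have [hp p0] := hcone_p hu Sxi; have hy := hcone_y hu Sxi.
have [_ _ _ _ [l0 _]] := hu; rewrite /hobj.
move: hp; rewrite s0 scale0r.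
set p := _ *m xi + hp0 u in p0 *; set y := _ *m xi + hy0 u in hy *; move=> hp.
have dual (z : 'cV[R]_n) (g : 'cV[R]_m) : mxle (A D *m z) g -> dotv ((A D)^T *m p) z <= dotv g p.
  move=> hz; rewrite dotvC dotv_mulmx trmxK -subr_ge0 -dotvBl dotv_nneg // => i j.
  by rewrite !mxE subr_ge0; have := hz i j; rewrite mxE.
have [lz|lnz] := eqVneq (hlambda u) 0.
  have y0 : y = 0 by apply: mulA_le0; rewrite -(scale0r (bx_of D x xi)) -lz.
  have [[z /dual hz] _] := hYx Sxi.
  move: hp hz; rewrite lz scale0r addr0 => ->; rewrite dotv0l.
  by rewrite y0 dotv0r addr0.
have lgt0 : 0 < hlambda u by rewrite lt_def lnz.
rewrite -(pmulr_rge0 _ lgt0) mulrDr -!dotvZl; apply: le_trans (lerD (dual _ _ hy) (lexx _)).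
by rewrite -dotvDl hp dotv0l.
Qed.

End HomogenizedLDR.

(** * Dual attainment for linear decision rules *)

Section LDRDual.
Variables (R : realType) (d m n k l : nat) (D : data R d m n k l) (Sh : 'M[R]_k).
Variable x : {ffun 'I_d -> bool}.
Hypotheses (hS : compact (supp D))
  (hemp : empirical_moments (supp D) (mu0 D) (Sigma0 D))
  (hSigma : pdmx (Sigma0 D))
  (hSh : is_sqrtmx (Sigma0 D) Sh)
  (hgamma1 : 0 <= gamma1 D)
  (hgamma2 : 1 <= gamma2 D).
Local Notation S := (supp D).
Hypothesis hYx : forall xi, S xi ->
  let Yset := [set y : 'cV[R]_n | mxle (A D *m y) (bx_of D x xi)] in
  Yset !=set0 /\ bounded_set Yset.

(** The point mass at [mu0] has zero mean deviation and zero second moment about [mu0]; it provides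
    a first moment level. *)
Lemma dirac_DM : exists2 F : probability (borelV R k) R, DM D F &
  forall f : 'cV[R]_k -> R, continuous f -> ('E_F[f] = (f (mu0 D))%:E)%E.
Proof.
have p1 : \sum_(i < 1) (fun=> 1 : R) (i : nat) = 1 by rewrite big_ord1.
have [||F hF FE] := @discrete_DM R d m n k l D hS hSigma 1 (fun=> 1)
  (fun=> mu0 D) (fun=> ler01) p1 (fun=> supp_mu0 hemp).
- by rewrite big_ord1 subrr scaler0 /ellipsoid /= dotv0l.
- move=> u; rewrite big_ord1 subrr mul0mx scaler0 subr0 -scalemxAl dotvZr.
  by apply: mulr_ge0; [exact: le_trans hgamma2|exact: (pd_psd hSigma).2].
exists F => // f cf; rewrite FE; last exact: measurable_continuous.
by rewrite big_ord1 mul1r.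
Qed.

Lemma continuous_supp_ub (f : 'cV[R]_k -> R) : continuous f ->
  exists K, forall xi, S xi -> f xi <= K.
Proof.
move=> cf; have /compact_bounded[M [_ hM]] : compact (f @` S).
  by apply: continuous_compact => //; exact: continuous_subspaceT.
exists (M + 1) => xi Sxi; apply: le_trans (ler_norm _) _.
by apply: (hM (M + 1)); [rewrite ltrDl|exists xi].
Qed.

(* Generators that are recession directions along which the objective vanishes
   on the support are useless, and would prevent the dual from being attained. *)
Definition kept (u : hvar R m n k l) : Prop :=
  hs u != 0 \/ exists2 xi, S xi & hobj D x u xi != 0.

(** [moment_dual] is applied to the kept generators, with [alpha] the supremum of the levels, and
    its weights [a] assemble [us]. The worst-case cost of [u0] bounds the levels, which makes the
    supremum finite. *)
Lemma ldr_dual (u0 : hvar R m n k l) : hcone D x u0 -> hs u0 = 1 ->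
  exists (us : hvar R m n k l) (Q : 'M[R]_k) (q : 'cV[R]_k) (r t : R),
  [/\ hcone D x us /\ hs us = 1, psdmx Q,
      frob (gamma2 D *: Sigma0 D + mu0 D *m (mu0 D)^T) Q + dotv (mu0 D) q
        + Num.sqrt (gamma1 D) * enorm (Sh *m (q + 2 *: (Q *m mu0 D))) <= t,
      forall xi, S xi -> hobj D x us xi <= r + dotv xi (Q *m xi) + dotv q xi
    & forall u, hcone D x u -> hs u = 1 ->
        ((r + t)%:E <= ereal_sup [set 'E_F[hobj D x u] | F in DM D])%E].
Proof.
move=> hu0 s01.
have [sz [L hL]] := hcone_polyhedral D x.
have [g g1 g2] := polyhedral_cone_gens L sz.
have gC v : v \in g -> hcone D x v by move=> /g1 h; apply/hL.
pose g' := [seq v <- g | `[< kept v >]].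
have g'P (i : 'I_(size g')) : g'`_i \in g /\ kept g'`_i.
  by have := mem_nth 0 (ltn_ord i); rewrite mem_filter => /andP[/asboolP].
pose phi (xi : 'cV[R]_k) : 'cV[R]_(size g') := \col_i hobj D x g'`_i xi.
pose sigma : 'cV[R]_(size g') := \col_i hs g'`_i.
have cphi : contmx phi.
  move=> i j; rewrite (_ : (fun xi => _) = hobj D x g'`_i); first exact: continuous_hobj.
  by apply/funext => xi; rewrite mxE.
have sigma0 : mxle 0 sigma.
  by move=> i j; rewrite !mxE; have [/gC[_ _ _ _ [_ ?]] _] := g'P i.
have ray i : sigma i ord0 = 0 ->
    (forall xi, S xi -> 0 <= phi xi i ord0) /\ exists2 xi, S xi & 0 < phi xi i ord0.
  rewrite mxE => si; have [/gC hi [|[xi Sxi nz]]] := g'P i; first by rewrite si eqxx.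
  have ge0 z : S z -> 0 <= phi z i ord0.
    by move=> Sz; rewrite mxE; apply: hobj_recession.
  by split=> //; exists xi => //; rewrite lt_def ge0 // andbT mxE.
(* A level reached on the kept generators extends to the whole cone: both sides are linear in [u],
   and a dropped generator contributes zero to each. *)
have level_hobj s u : moment_level D phi sigma s -> hcone D x u ->
    exists2 F : probability (borelV R k) R, DM D F & s * hs u <= mean F (hobj D x u).
  move=> [F hF hs'] hu; exists F => //; have [FS _ _] := hF.
  have ch v : continuous (hobj D x v) by exact: continuous_hobj.
  have key v : v \in g -> s * hs v <= mean F (hobj D x v).
    move=> vg; have [kv|nkv] := pselect (kept v).
      have vg' : v \in g' by rewrite mem_filter vg andbT; apply/asboolP.
      have := vg'; rewrite -index_mem => lti.
      have := hs' (Ordinal lti); rewrite mxE /= nth_index //.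
      rewrite (_ : (fun xi => _) = hobj D x v).
        by rewrite (expectation_mean hS FS (ch v)) lee_fin.
      by apply/funext => xi; rewrite mxE /= nth_index.
    have s0 : hs v = 0 by apply: contrapT => /eqP h; apply: nkv; left.
    rewrite s0 mulr0 -(mean_cst F 0); apply: (mean_le hS FS) => //.
      exact: cst_continuous.
    move=> xi Sxi; rewrite le_eqVlt; apply/orP; left; apply/eqP/esym.
    by apply: contrapT => /eqP h; apply: nkv; right; exists xi.
  have [a a0 ->] : nonneg_comb g u by apply: g2; apply/hL.
  rewrite (lin_form_comb _ _ _ (@lin_hs R m n k l)) mulr_sumr.
  rewrite (_ : hobj D x _ = fun xi => \sum_(i < size g) a i * hobj D x g`_i xi).
    rewrite (mean_sum hS FS) => [|i]; last by apply: continuous_mul => //; exact: cst_continuous.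
    apply: ler_sum => i _; rewrite (meanZ hS FS) // mulrCA ler_wpM2l //.
    by apply: key; rewrite mem_nth.
  by apply/funext => xi; rewrite (lin_form_comb _ _ _ (lin_hobj D x xi)).
have level_ne0 : moment_level D phi sigma !=set0.
  have [F hF FE] := dirac_DM.
  (* Minus the sum of the [c i] is a level low enough for every index at [mu0]; where [sigma i = 0]
     the quotient is 0 and [ray] takes over. *)
  pose c (i : 'I_(size g')) := `|phi (mu0 D) i ord0| / sigma i ord0.
  have c0 i : 0 <= c i.
    by rewrite divr_ge0 //; have := sigma0 i ord0; rewrite [X in X <= _]mxE.
  exists (- \sum_i c i); exists F => // i; rewrite FE; last exact: cphi.
  rewrite lee_fin; have [s0|s0] := eqVneq (sigma i ord0) 0.
    by rewrite s0 mulr0; have [h _] := ray i s0; apply: h; exact: supp_mu0.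
  have sgt0 : 0 < sigma i ord0.
    by rewrite lt_def s0; have := sigma0 i ord0; rewrite [X in X <= _]mxE.
  apply: (@le_trans _ _ (- c i * sigma i ord0)).
    apply: ler_wpM2r; first exact: ltW.
    rewrite lerN2 (bigD1 i) //= lerDl.
    by apply: sumr_ge0 => j _.
  by rewrite mulNr divfK // lerNl ler_normr lexx orbT.
have [K hK] := continuous_supp_ub (@continuous_hobj R d m n k l D x u0).
have level_ub s : moment_level D phi sigma s -> s <= K.
  move=> /level_hobj/(_ hu0)[F [FS _ _]]; rewrite s01 mulr1 => h; apply: le_trans h _.
  rewrite -(mean_cst F K); apply: (mean_le hS FS) => //.
    exact: continuous_hobj.
  exact: cst_continuous.
have level_sup : has_sup (moment_level D phi sigma) by split=> //; exists K.
pose alpha := sup (moment_level D phi sigma).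
have alpha_ub s : moment_level D phi sigma s -> s <= alpha by exact: ub_le_sup level_sup.2 _.
have [a [Q [q [r [t [[a0 a1] hQ ht rt main]]]]]] :=
  moment_dual hS hemp hSigma hSh hgamma1 hgamma2 cphi sigma0 ray alpha_ub.
have ai i : 0 <= a i ord0 by have := a0 i ord0; rewrite mxE.
pose us := \sum_(i < size g') a i ord0 *: g'`_i.
have husC : hcone D x us.
  apply/hL => i lti; rewrite linear_comb; apply: sumr_ge0 => j _.
  by rewrite mulr_ge0 //; exact: (g1 _ (g'P j).1).
exists us, Q, q, r, t; split=> //.
- split=> //; rewrite /us (lin_form_comb _ _ _ (@lin_hs R m n k l)) -[RHS]a1 dotvE.
  by apply: eq_bigr => i _; rewrite mxE.
- move=> xi Sxi; apply: le_trans (main xi Sxi).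
  rewrite /us (lin_form_comb _ _ _ (lin_hobj D x xi)) dotvE.
  by apply: ler_sum => i _; rewrite mxE.
(* Each level is at most the worst-case cost of [u], hence so is their supremum [alpha = r + t]. *)
move=> u hu s1; rewrite rt -ereal_sup_EFin //; last exact: level_sup.2.
apply: ge_ereal_sup => _ [s hs' <-]; have [F hF] := level_hobj s u hs' hu.
rewrite s1 mulr1 => h; apply: (@le_trans _ _ ('E_F[hobj D x u])%E).
  have [FS _ _] := hF.
  by rewrite (expectation_mean hS FS (@continuous_hobj R d m n k l D x u)) lee_fin.
by apply: ereal_sup_ubound; exists F.
Qed.

End LDRDual.

(** * The copositive program *)

Section BigM.
Variables (R : realType) (d : nat) (x : {ffun 'I_d -> bool}) (i : 'I_d).

(** For [x i = 1] the first two bounds coincide, for [x i = 0] the last two. *)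
Lemma bigM_eq p q (M : R) (U Z : 'M[R]_(p, q)) :
  bigM M (bit R x i) U Z -> Z = bit R x i *: U.
Proof.
rewrite /bit => -[h1 h2 h3 h4]; apply/matrixP => a c.
have := h1 a c; have := h2 a c; have := h3 a c; have := h4 a c; rewrite !mxE.
by case: (x i) => /=; lra.
Qed.

Lemma bigM_intro p q (M : R) (U : 'M[R]_(p, q)) :
  `|U| <= M -> bigM M (bit R x i) U (bit R x i *: U).
Proof.
move=> hU; have hM a c : - M <= U a c <= M.
  rewrite -ler_norml; apply: le_trans hU; rewrite [leRHS]mx_normrE.
  exact: (le_bigmax _ (fun ij : 'I_p * 'I_q => `|U ij.1 ij.2|) (a, c)).
rewrite /bit; split=> a c; have := hM a c; rewrite !mxE; case: (x i) => /=; lra.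
Qed.

End BigM.

(** * Copositivity as a quadratic majorant, and both directions of the reformulation *)

Section Reformulation.
Variables (R : realType) (d m n k l : nat) (D : data R d m n k l) (Sh : 'M[R]_k).
Hypotheses (hS : compact (supp D))
  (hemp : empirical_moments (supp D) (mu0 D) (Sigma0 D))
  (hSigma : pdmx (Sigma0 D))
  (hSh : is_sqrtmx (Sigma0 D) Sh)
  (hgamma1 : 0 <= gamma1 D)
  (hgamma2 : 1 <= gamma2 D).
Local Notation S := (supp D).

Definition hom (xi : 'cV[R]_k) : 'cV[R]_(k + 1) := col_mx xi 1%:M.

Lemma Xihat_hom z : Xihat D z -> exists2 xi, S xi & exists t, z = t *: hom xi.
Proof.
rewrite /Xihat /calH -[z]vsubmxK [dsubmx z]mx11_scalar /= mul_row_col mul_mx_scalar.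
set t := dsubmx z ord0 ord0; set y := usubmx z => hz.
have [|xi Sxi ->] := @supp_homogenize R d m n k l D hS hemp y t.
  by move=> i; have := hz i ord0; rewrite !mxE; lra.
exists xi => //; exists t.
by rewrite /hom scale_col_mx scale_scalar_mx mulr1.
Qed.

Lemma hom_Xihat xi : S xi -> Xihat D (hom xi).
Proof.
move=> Sxi i j; rewrite /calH /hom mul_row_col mulmx1 !mxE subr_ge0.
by have := Sxi i j; rewrite mxE.
Qed.

(** Every point of the cone is a multiple of some [hom xi] with [xi] in the support, and scaling
    multiplies a quadratic form by a square. *)
Lemma COP_XihatP (X : 'M[R]_(k + 1)) : COP (Xihat D) X <->
  symmx X /\ forall xi, S xi -> 0 <= dotv (hom xi) (X *m hom xi).
Proof.
split=> -[sX hX]; split=> //.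
  by move=> xi Sxi; apply: hX; exact: hom_Xihat.
move=> z /Xihat_hom[xi Sxi [t ->]].
by rewrite -scalemxAr dotvZr dotvZl mulrA -expr2 mulr_ge0 ?sqr_ge0 // hX.
Qed.

Lemma elast_hom xi : dotv (elast R k) (hom xi) = 1.
Proof. by rewrite /elast dotv_delta /hom col_mxEd mxE eqxx. Qed.

Implicit Types v : cop_var R d m n k l.

(** What the big-M constraints say about the products that enter [calQ]; [theta] enters only the
    linear constraints and is treated in [FM_hcone]. *)
Definition linearized v : Prop := forall i,
  [/\ cop_Gamma v i = bit R (cop_x v) i *: ((B D i)^T *m (cop_T v *m W D)),
      cop_omega v i = bit R (cop_x v) i *: cop_p0 v
    & cop_rho v i = bit R (cop_x v) i *: ((cop_T v *m W D)^T *m b D i)].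

Definition hvar_of v : hvar R m n k l :=
  (cop_T v, cop_Lambda v, cop_p0 v, cop_Y v, cop_y0 v, cop_lambda v, 1).

Lemma calQ_linearized v : linearized v ->
  let TW := cop_T v *m W D in
  let N := (Bx D (cop_x v))^T *m TW + (cC D)^T *m cop_Y v in
  let g := 2^-1 *: ((Bx D (cop_x v))^T *m cop_p0 v + TW^T *m bx0 D (cop_x v)
             + (cC D)^T *m cop_y0 v + (cop_Y v)^T *m cc0 D - cop_q v) in
  calQ D v = block_mx (2^-1 *: (N + N^T) - cop_Q v) g g^T
    ((bx0 D (cop_x v))^T *m cop_p0 v + (cc0 D)^T *m cop_y0 v).
Proof.
move=> hv TW N g; rewrite /calQ -/TW.
have BxT : (Bx D (cop_x v))^T = \sum_i bit R (cop_x v) i *: (B D i)^T + (B0 D)^T.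
  by rewrite /Bx linearD linear_sum /=; congr (_ + _); apply: eq_bigr => i _; rewrite linearZ.
have NE : \sum_i cop_Gamma v i + (B0 D)^T *m TW + (cC D)^T *m cop_Y v = N.
  rewrite /N BxT mulmxDl mulmx_suml; congr (_ + _ + _); apply: eq_bigr => i _.
  by have [-> _ _] := hv i; rewrite scalemxAl.
have gE : 2^-1 *: (\sum_i (B D i)^T *m cop_omega v i + (B0 D)^T *m cop_p0 v
    + \sum_i cop_rho v i + TW^T *m b0 D + (cC D)^T *m cop_y0 v + (cop_Y v)^T *m cc0 D
    - cop_q v) = g.
  rewrite /g BxT /bx0 mulmxDl mulmxDr mulmx_suml mulmx_sumr.
  congr (_ *: (_ + _ + _ - _)); rewrite -!addrA; congr (_ + (_ + (_ + _))).
    by apply: eq_bigr => i _; have [_ -> _] := hv i; rewrite -scalemxAl scalemxAr.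
  by apply: eq_bigr => i _; have [_ _ ->] := hv i; rewrite scalemxAr.
by rewrite NE gE.
Qed.

(** At [(xi, 1)] the form is the gap between the quadratic majorant and the cost, so copositivity
    says that the majorant dominates the cost on the support. *)
Lemma calQ_form v xi : linearized v ->
  dotv (hom xi) ((cop_r v *: (elast R k *m (elast R k)^T) - calQ D v) *m hom xi)
  = cop_r v + dotv xi (cop_Q v *m xi) + dotv (cop_q v) xi
    - hobj D (cop_x v) (hvar_of v) xi.
Proof.
move=> hv; rewrite calQ_linearized // mulmxBl dotvBr -scalemxAl dotvZr.
have -> : dotv (hom xi) (elast R k *m (elast R k)^T *m hom xi) = 1.
  rewrite -mulmxA [(elast R k)^T *m _]mx11_scalar -/(dotv _ _) elast_hom mulmx1.
  by rewrite dotvC elast_hom.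
rewrite mulr1 /hom mul_block_col mulmx1 dotv_col_mx.
set N := _ *m _ + (cC D)^T *m _; set g := 2^-1 *: (_ - cop_q v).
have one (s : 'M[R]_1) : dotv 1%:M s = s ord0 ord0 by rewrite /dotv trmx1 mul1mx.
have scal p (u w : 'cV[R]_p) : (u^T *m w) ord0 ord0 = dotv u w by [].
rewrite [dotv 1%:M _]dotvDr mulmx1 [dotv 1%:M (_ + _)]dotvDr !one !scal.
have gxi : dotv g xi = 2^-1 * (dotv (cop_p0 v) (Bx D (cop_x v) *m xi)
    + dotv (bx0 D (cop_x v)) (cop_T v *m W D *m xi)
    + dotv (cop_y0 v) (cC D *m xi) + dotv (cc0 D) (cop_Y v *m xi) - dotv (cop_q v) xi).
  by rewrite /g dotvZl dotvBl 3!dotvDl -!dotv_mulmx.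
have Nxi : dotv xi ((2^-1 *: (N + N^T) - cop_Q v) *m xi) = dotv xi (N *m xi) - dotv xi (cop_Q v *m xi).
  rewrite mulmxBl dotvBr -scalemxAl dotvZr mulmxDl dotvDr (dotv_mulmx N^T) trmxK (dotvC (N *m xi)).
  by field.
have NE : dotv xi (N *m xi) = dotv (Bx D (cop_x v) *m xi) (cop_T v *m W D *m xi)
    + dotv (cC D *m xi) (cop_Y v *m xi).
  by rewrite /N mulmxDl dotvDr -!mulmxA !dotv_mulmx !trmxK !mulmxA.
rewrite dotvDr Nxi NE (dotvC xi g) gxi /hobj /bx_of /c_of /=.
move: (bx0 D (cop_x v)) (Bx D (cop_x v)) => bb BB; rewrite !dotvDl !dotvDr.
rewrite (dotvC (cop_p0 v)) (dotvC (cop_y0 v) (cC D *m xi)).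
by field.
Qed.

Lemma calQ_symm v : symmx (cop_Q v) -> linearized v ->
  symmx (cop_r v *: (elast R k *m (elast R k)^T) - calQ D v).
Proof.
move=> sQ hv; rewrite calQ_linearized // /symmx.
rewrite linearB linearZ /= trmx_mul trmxK tr_block_mx trmxK.
congr (_ - block_mx _ _ _ _).
  by rewrite linearB linearZ /= linearD /= trmxK sQ [X in _ *: X]addrC.
by apply/matrixP => i j; rewrite !ord1 mxE.
Qed.

Lemma FM_linearized M v : FM D Sh M v -> linearized v.
Proof.
move=> [_ _ hi _ _] i; have [hG _ ho hr] := hi i.
by split; [exact: bigM_eq hG|exact: bigM_eq ho|exact: bigM_eq hr].
Qed.

Lemma FM_hcone M v : FM D Sh M v -> hcone D (cop_x v) (hvar_of v).
Proof.
move=> [_ [_ _ l0] hi [e1 e2 e3] [e4 e5 e6 e7]].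
have theta i : cop_theta v i = bit R (cop_x v) i * cop_lambda v.
  have [_ [/andP[h1 h2] /andP[h3 h4]] _ _] := hi i; move: h1 h2 h3 h4; rewrite /bit.
  by case: (cop_x v i) => /=; lra.
have sumE (V : lmodType R) (f : 'I_d -> V) (f0 : V) :
    \sum_i cop_theta v i *: f i + cop_lambda v *: f0
    = cop_lambda v *: (\sum_i bit R (cop_x v) i *: f i + f0).
  rewrite scalerDr scaler_sumr; congr (_ + _); apply: eq_bigr => i _.
  by rewrite theta scalerA mulrC.
split; rewrite /hvar_of /hT /hLambda /hp0 /hY /hy0 /hlambda /hs /=.
- by rewrite e4 e5 !scale1r !subrr.
- split=> i j; first by have := e6 i j; rewrite [X in X <= _]mxE.
  by have := e7 i j; rewrite mxE.
- by rewrite e1 sumE subrr.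
- split=> i j; last by have := e3 i j; rewrite mxE.
  by have := e2 i j; rewrite -addrA sumE [X in X <= _]mxE.
- by [].
Qed.

(** The decision rule has [P = T W]; copositivity supplies the majorant required by
    [weak_duality]. *)
Lemma cop_to_ldr M v : cop_feasible D Sh M v ->
  exists u, [/\ ldr_feasible D u, ldr_x u = cop_x v
    & (ldr_objective D u <= cop_objective D v)%E].
Proof.
move=> [hFM /COP_XihatP[_ hcop]]; have hv := FM_linearized hFM.
have hc := FM_hcone hFM; have [hx [ht hQ l0] _ _ _] := hFM.
pose u := LdrVar (cop_x v) (cop_lambda v) (cop_T v *m W D) (cop_p0 v) (cop_Y v) (cop_y0 v).
exists u; split=> //.
  split=> // xi Sxi; have [h1 h2] := hcone_p hc Sxi; split=> //.
    by rewrite [LHS]h1 scale1r.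
  exact: hcone_y hc Sxi.
rewrite /ldr_objective /cop_objective -addrA EFinD leeD2l //.
apply: ge_ereal_sup => _ [F hF <-].
apply: (weak_duality hS hSigma hSh hF _ hQ _ ht).
  exact: (@continuous_hobj R d m n k l D (cop_x v) (hvar_of v)).
by move=> xi Sxi; have := hcop xi Sxi; rewrite calQ_form // subr_ge0.
Qed.

(** The equality holds on a set with an interior point, so its coefficients match; the two
    inequalities yield [T] and [Lambda] by the affine Farkas lemma. *)
Lemma ldr_to_hcone u : ldr_feasible D u -> exists w : hvar R m n k l,
  [/\ hcone D (ldr_x u) w, hs w = 1 & ldr_objective D u =
    ((wx D (ldr_x u))%:E + ereal_sup [set 'E_F[hobj D (ldr_x u) w] | F in DM D])%E].
Proof.
move=> [hx l0 hu].
have [e1 e2] : (A D)^T *m ldr_P u + ldr_lambda u *: cC D - vV D = 0 /\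
    (A D)^T *m ldr_p0 u + ldr_lambda u *: cc0 D - vv0 D = 0.
  apply: (supp_affine_eq0 hemp hSigma) => xi /hu[h _ _].
  move/eqP: h; rewrite -subr_eq0 => /eqP <-; rewrite /ldr_p /c_of /v_of.
  rewrite mulmxDr scalerDr opprD !mulmxBl mulmxDl !mulmxA -!scalemxAl.
  by rewrite [X in _ = X + _]addrACA [RHS]addrACA.
have [T [T0 TW hT0]] : exists T : 'M[R]_(m, l),
    [/\ mxle 0 T, T *m W D = ldr_P u & mxle 0 (T *m h D + ldr_p0 u)].
  by apply: (affine_farkas_mx hS hemp) => xi /hu[_ h _].
have [L [L0 LW hL0]] : exists L : 'M[R]_(m, l), [/\ mxle 0 L,
    L *m W D = ldr_lambda u *: Bx D (ldr_x u) - A D *m ldr_Y u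
    & mxle 0 (L *m h D + (ldr_lambda u *: bx0 D (ldr_x u) - A D *m ldr_y0 u))].
  apply: (affine_farkas_mx hS hemp) => xi /hu[_ _ h] i j; rewrite mxE.
  have := h i j; rewrite -subr_ge0 => h'; apply: le_trans h' _.
  rewrite /bx_of /ldr_y mulmxDr scalerDr mulmxBl !mulmxA -!scalemxAl !mxE.
  by rewrite le_eqVlt; apply/orP; left; apply/eqP; ring.
exists (T, L, ldr_p0 u, ldr_Y u, ldr_y0 u, ldr_lambda u, 1); split=> //.
  split; rewrite /hT /hLambda /hp0 /hY /hy0 /hlambda /hs /=.
  - by rewrite TW !scale1r e1 e2.
  - split=> i j; first by have := hT0 i j; rewrite [X in X <= _]mxE.
    by have := T0 i j; rewrite mxE.
  - by rewrite LW addrCA subrr addr0 subrr.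
  - split=> i j; last by have := L0 i j; rewrite mxE.
    have := hL0 i j; rewrite [X in X <= _]mxE => h.
    by rewrite -addrA [- _ + _]addrC.
  - by split=> //; exact: ler01.
rewrite /ldr_objective; congr (_ + ereal_sup _)%E; congr image.
by apply/funext => F; rewrite /hobj /hT /hp0 /hY /hy0 /= TW.
Qed.

(** [ldr_dual] gives one tuple that is best for this [x]. Giving the linearized products their exact
    values makes it feasible as soon as [M] dominates their factors. *)
Lemma ldr_to_cop (x : {ffun 'I_d -> bool}) : standing_bounded D ->
  exists2 M0 : R, 0 < M0 & forall M u0, M0 <= M -> ldr_feasible D u0 -> ldr_x u0 = x ->
    exists v, [/\ cop_feasible D Sh M v, cop_x v = x &
      forall u, ldr_feasible D u -> ldr_x u = x ->
        (cop_objective D v <= ldr_objective D u)%E].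
Proof.
move=> hbnd.
have [[u0 [hu0 x0]]|none] := pselect (exists u, ldr_feasible D u /\ ldr_x u = x); last first.
  (* Without a feasible rule for [x] the claim is vacuous and any positive constant serves. *)
  by exists 1 => // M u0 _ h1 h2; exfalso; apply: none; exists u0.
have hx : x \in X D by have [] := hu0; rewrite x0.
have hYx : forall xi, S xi ->
    let Yset := [set y : 'cV[R]_n | mxle (A D *m y) (bx_of D x xi)] in
    Yset !=set0 /\ bounded_set Yset.
  apply: (DM_ae_supp hS hemp hSigma hSh hgamma1 hgamma2) => F hF; exact: hbnd.
have [w0 [hw0 s0 _]] := ldr_to_hcone hu0; rewrite x0 in hw0.
have [us [Q [q [r [t [[hus sus] hQ ht main opt]]]]]] :=
  ldr_dual hS hemp hSigma hSh hgamma1 hgamma2 hYx hw0 s0.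
pose TW := hT us *m W D.
(* [hlambda us] covers the constraints on [theta], the norm of [hp0 us] those on [omega], and the
   sum those on [Gamma] and [rho]. *)
pose M0 := 1 + hlambda us + `|hp0 us|
  + \sum_i (`|(B D i)^T *m TW| + `|TW^T *m b D i|).
have [[e1 e2] [e3 e4] e5 [e6 e7] [l0 _]] := hus.
have sum0 : 0 <= \sum_i (`|(B D i)^T *m TW| + `|TW^T *m b D i|).
  by apply: sumr_ge0 => i _; rewrite addr_ge0.
have p00 := normr_ge0 (hp0 us).
have sumi i : `|(B D i)^T *m TW| + `|TW^T *m b D i|
    <= \sum_i (`|(B D i)^T *m TW| + `|TW^T *m b D i|).
  by rewrite [leRHS](bigD1 i) //= lerDl; apply: sumr_ge0 => j _; rewrite addr_ge0.
exists M0; first by rewrite /M0; lra.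
move=> M u1 hM _ _.
pose v := CopVar Q q r t (hY us) (hy0 us) (hp0 us) (hlambda us) (hT us) (hLambda us)
  (fun i => bit R x i * hlambda us) (fun i => bit R x i *: ((B D i)^T *m TW))
  (fun i => bit R x i *: hp0 us) (fun i => bit R x i *: (TW^T *m b D i)) x.
have hv : linearized v by [].
have usE : hvar_of v = us.
  rewrite /hvar_of /v /= -sus.
  by case: (us) => [[[[[[? ?] ?] ?] ?] ?] ?].
have sumE (V : lmodType R) (f : 'I_d -> V) (f0 : V) :
    \sum_i (bit R x i * hlambda us) *: f i + hlambda us *: f0
    = hlambda us *: (\sum_i bit R x i *: f i + f0).
  rewrite scalerDr scaler_sumr; congr (_ + _); apply: eq_bigr => i _.
  by rewrite scalerA mulrC.
exists v; split=> //.
  split.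
    split=> //=.
    - move=> i; have := sumi i; have n1 := normr_ge0 ((B D i)^T *m TW).
      have n2 := normr_ge0 (TW^T *m b D i); move: hM; rewrite /M0 => hM hsum.
      split; [apply: bigM_intro; lra| |apply: bigM_intro; lra|apply: bigM_intro; lra].
      by rewrite /bit; case: (x i) => /=; split; apply/andP; split; lra.
    - split; last by move=> i j; rewrite mxE.
        by rewrite sumE; apply/eqP; rewrite -subr_eq0; apply/eqP.
      by move=> i j; rewrite -addrA sumE [X in X <= _]mxE.
    - split.
      + by move/eqP: e1; rewrite sus scale1r subr_eq0 => /eqP.
      + by move/eqP: e2; rewrite sus scale1r subr_eq0 => /eqP.
      + by move=> i j; rewrite [X in X <= _]mxE.
      + by move=> i j; rewrite mxE.
  apply/COP_XihatP; split; first by apply: calQ_symm => //; case: hQ.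
  by move=> xi Sxi; rewrite calQ_form // usE subr_ge0; exact: main.
move=> u hu xu; have [w [hw sw ->]] := ldr_to_hcone hu.
rewrite xu in hw *; rewrite /cop_objective /= -addrA EFinD leeD2l //; exact: opt.
Qed.

End Reformulation.

Theorem theorem3 (R : realType) (d m n k l : nat) (D : data R d m n k l)
    (Sh : 'M[R]_k)
    (hS : compact (supp D))
    (hemp : empirical_moments (supp D) (mu0 D) (Sigma0 D))
    (hSigma : pdmx (Sigma0 D))
    (hSh : is_sqrtmx (Sigma0 D) Sh)
    (hgamma1 : 0 <= gamma1 D)
    (hgamma2 : 1 <= gamma2 D)
    (hint : standing_integrability D)
    (hbnd : standing_bounded D)
    (hfull : interior (Xihat D) !=set0) :
  exists M0 : R, 0 < M0 /\ forall M : R, M0 <= M ->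
    exact_reformulation
      (ldr_feasible D) (ldr_objective D) (@ldr_x R d m n k)
      (cop_feasible D Sh M) (cop_objective D) (@cop_x R d m n k l).
Proof.
have /choice[M0 hM0] : forall x : {ffun 'I_d -> bool}, exists M0 : R, 0 < M0 /\
    forall M u0, M0 <= M -> ldr_feasible D u0 -> ldr_x u0 = x ->
    exists v, [/\ cop_feasible D Sh M v, cop_x v = x &
      forall u, ldr_feasible D u -> ldr_x u = x ->
        (cop_objective D v <= ldr_objective D u)%E].
  by move=> x; have [M0] := ldr_to_cop hS hemp hSigma hSh hgamma1 hgamma2 x hbnd; exists M0.
have M00 x : 0 <= M0 x by apply: ltW; have [] := hM0 x.
(* The sum over the finitely many [x] dominates each [M0 x]. *)
exists (1 + \sum_x M0 x); split; first by rewrite ltr_pwDl // sumr_ge0.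
move=> M hM.
have M0M x : M0 x <= M.
  apply: le_trans hM; rewrite (bigD1 x) //= addrCA lerDl addr_ge0 //.
  by apply: sumr_ge0.
(* [down] and [up] keep the decision [x] and do not increase the objective, which gives equal infima
   and transfers minimizers both ways. *)
have down v : cop_feasible D Sh M v -> exists u, [/\ ldr_feasible D u,
    ldr_x u = cop_x v & (ldr_objective D u <= cop_objective D v)%E].
  exact: (cop_to_ldr hS hemp hSigma hSh).
have up u : ldr_feasible D u -> exists v, [/\ cop_feasible D Sh M v,
    cop_x v = ldr_x u & (cop_objective D v <= ldr_objective D u)%E].
  move=> hu; have [_ /(_ M u (M0M _) hu erefl)[v [hv xv le]]] := hM0 (ldr_x u).
  by exists v; split=> //; exact: le.
split.
  apply/eqP; rewrite eq_le; apply/andP; split.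
    apply/ereal_infP => _ [v /down[u [hu _ le]] <-].
    by apply: le_trans le; apply: ereal_inf_lbound; exists u.
  apply/ereal_infP => _ [u /up[v [hv _ le]] <-].
  by apply: le_trans le; apply: ereal_inf_lbound; exists v.
apply/seteqP; split=> z.
  move=> [u [hu opt] <-]; have [v [hv xv le]] := up u hu.
  exists v => //; split=> // v' /down[u' [hu' _ le']].
  by apply: le_trans le (le_trans (opt u' hu') le').
move=> [v [hv opt] <-]; have [u [hu xu le]] := down v hv.
exists u => //; split=> // u' /up[v' [hv' _ le']].
by apply: le_trans le (le_trans (opt v' hv') le').
Qed.
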